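(* Let $M>0$, let $z_1,z_2,z_3\in\mathbb{C}$ be pairwise distinct, $\rho_{ij}=|z_i-z_j|^2$, and let $c>0$ with $c\notin\{1/3,1\}$. For $\omega=(\omega_1,\omega_2,\omega_3)\in(0,\infty)^3$ define $\mathcal I^{(0)}(\omega)$ and $\mathcal I^{(1)}(\omega)$ as the triple inverse Mellin integrals given in the context. Put $\mathcal D_i=-\omega_i\,\partial/\partial\omega_i$ for $i=1,2,3$. Then $$\mathcal I^{(1)}=\mathcal O\,\mathcal I^{(0)}\quad\text{on }(0,\infty)^3,$$ where $\mathcal O$ is the differential operator $$\mathcal O=\tfrac14\Big[\ln\rho_{12}\,(\mathcal D_1^2+\mathcal D_2^2-\mathcal D_3^2+4\mathcal D_3-5)+\ln\rho_{13}\,(\mathcal D_1^2+\mathcal D_3^2-\mathcal D_2^2-4\mathcal D_3+3)+\ln\rho_{23}\,(\mathcal D_3^2+\mathcal D_2^2-\mathcal D_1^2-4\mathcal D_3+3)\Big]-\gamma_E(\mathcal D_1+\mathcal D_2+\mathcal D_3-1).$$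
   Context: $\gamma_E$ is the Euler--Mascheroni constant. The quantities $\rho_{ij}$ are held fixed (independent of $\omega$) when differentiating. Let $$\mathcal K(\Delta;\omega)=M^{\Delta_1+\Delta_2+\Delta_3-1}\omega_1^{-\Delta_1}\omega_2^{-\Delta_2}\omega_3^{-\Delta_3}\,\Gamma\Big(\tfrac{\Delta_1+\Delta_2+\Delta_3-1}{2}\Big)\Gamma\Big(\tfrac{\Delta_1+\Delta_3-\Delta_2-1}{2}\Big)\Gamma\Big(\tfrac{\Delta_2+\Delta_3-\Delta_1-1}{2}\Big)\Gamma\Big(\tfrac{\Delta_1+\Delta_2-\Delta_3+3}{2}\Big)$$ $$\qquad\times\rho_{12}^{\frac12(\Delta_3-\Delta_1-\Delta_2-3)}\,\rho_{13}^{\frac12(\Delta_2-\Delta_1-\Delta_3+1)}\,\rho_{23}^{\frac12(\Delta_1-\Delta_2-\Delta_3+1)}$$ and $$R(\Delta)=\tfrac14\Big[(\Delta_1^2+\Delta_2^2-\Delta_3^2+4\Delta_3-5)\ln\rho_{12}+(\Delta_1^2+\Delta_3^2-\Delta_2^2-4\Delta_3+3)\ln\rho_{13}+(\Delta_3^2+\Delta_2^2-\Delta_1^2-4\Delta_3+3)\ln\rho_{23}\Big]-\gamma_E(\Delta_1+\Delta_2+\Delta_3-1).$$ Then, integrating each $\Delta_j$ upward along $\mathrm{Re}\,\Delta_j=c$, $$\mathcal I^{(0)}(\omega)=\Big(\frac1{2\pi i}\Big)^3\int\!\!\int\!\!\int \mathcal K(\Delta;\omega)\,d\Delta_1d\Delta_2d\Delta_3,\qquad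 \mathcal I^{(1)}(\omega)=\Big(\frac1{2\pi i}\Big)^3\int\!\!\int\!\!\int R(\Delta)\,\mathcal K(\Delta;\omega)\,d\Delta_1d\Delta_2d\Delta_3.$$ Complex powers of positive reals use the real logarithm. *)

(* Defs.v *)
From HB Require Import structures.
From mathcomp Require Import all_boot all_order all_algebra.
From mathcomp Require Import all_classical all_reals all_analysis.
From mathcomp Require Import complex.

Set Implicit Arguments.
Unset Strict Implicit.
Unset Printing Implicit Defensive.

Import Order.TTheory GRing.Theory Num.Theory.
Import numFieldNormedType.Exports.

Local Open Scope classical_set_scope.
Local Open Scope ring_scope.
Local Open Scope complex_scope.

(* Integrals and derivatives of complex-valued functions are taken
   componentwise: R[i] carries no normed structure over R in the library. *)
Definition cintegrable d (T : measurableType d) (R : realType)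
    (mu : {measure set T -> \bar R}) (D : set T) (f : T -> R[i]) : Prop :=
  mu.-integrable D (fun t => (complex.Re (f t))%:E) /\
  mu.-integrable D (fun t => (complex.Im (f t))%:E).

Definition cintegral d (T : measurableType d) (R : realType)
    (mu : {measure set T -> \bar R}) (D : set T) (f : T -> R[i]) : R[i] :=
  Rintegral mu D (fun t => complex.Re (f t))
    +i* Rintegral mu D (fun t => complex.Im (f t)).

Definition cderivable (R : realType) (f : R -> R[i]) (x : R) : Prop :=
  derivable (fun u => complex.Re (f u)) x 1 /\
  derivable (fun u => complex.Im (f u)) x 1.

Definition cderive (R : realType) (f : R -> R[i]) (x : R) : R[i] :=
  derive1 (fun u => complex.Re (f u)) x
    +i* derive1 (fun u => complex.Im (f u)) x.

Definition cexp (R : realType) (z : R[i]) : R[i] :=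
  (expR (complex.Re z))%:C * (cos (complex.Im z) +i* sin (complex.Im z)).

(* a ^ z for a real base a > 0 *)
Definition cpow (R : realType) (a : R) (z : R[i]) : R[i] :=
  cexp ((ln a)%:C * z).

(* Euler's integral, meaningful for Re z > 0 *)
Definition euler_gamma (R : realType) (z : R[i]) : R[i] :=
  cintegral (@lebesgue_measure R) `]0, +oo[%classic
    (fun t => cpow t (z - 1) * (expR (- t))%:C).

(* The meromorphic continuation Gamma(z) = Gamma(z + n) / (z (z+1) ... (z+n-1)),
   where n is the least natural number such that Re z + n > 0; in particular
   n = 0 when Re z > 0.  The values at the poles are irrelevant. *)
Definition cgamma (R : realType) (z : R[i]) : R[i] :=
  let n := Num.truncn (1 - complex.Re z) in
  euler_gamma (z + n%:R) / \prod_(k < n) (z + k%:R).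

(* Euler--Mascheroni constant *)
Definition gammaE (R : realType) : R :=
  limn (fun n : nat => \sum_(1 <= k < n.+1) (k%:R)^-1 - ln (n%:R) : R).

(* rho_ij; the norm of R[i] takes values in R[i] *)
Definition sqdist (R : realType) (z w : R[i]) : R := complex.Re `|z - w| ^+ 2.

Definition kernelK (R : realType) (M r12 r13 r23 w1 w2 w3 : R)
    (D1 D2 D3 : R[i]) : R[i] :=
  cpow M (D1 + D2 + D3 - 1)
  * cpow w1 (- D1) * cpow w2 (- D2) * cpow w3 (- D3)
  * cgamma ((D1 + D2 + D3 - 1) / 2) * cgamma ((D1 + D3 - D2 - 1) / 2)
  * cgamma ((D2 + D3 - D1 - 1) / 2) * cgamma ((D1 + D2 - D3 + 3) / 2)
  * cpow r12 (1 / 2 * (D3 - D1 - D2 - 3))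
  * cpow r13 (1 / 2 * (D2 - D1 - D3 + 1))
  * cpow r23 (1 / 2 * (D1 - D2 - D3 + 1)).

Definition symbolR (R : realType) (r12 r13 r23 : R) (D1 D2 D3 : R[i]) : R[i] :=
  1 / 4 *
    ((D1 ^+ 2 + D2 ^+ 2 - D3 ^+ 2 + 4 * D3 - 5) * (ln r12)%:C
     + (D1 ^+ 2 + D3 ^+ 2 - D2 ^+ 2 - 4 * D3 + 3) * (ln r13)%:C
     + (D3 ^+ 2 + D2 ^+ 2 - D1 ^+ 2 - 4 * D3 + 3) * (ln r23)%:C)
  - (gammaE R)%:C * (D1 + D2 + D3 - 1).

(* Lebesgue measure on R * R.  The sigma-finite structure has to be declared
   because the library's one on m1 \x m2 is not found by unification. *)
Definition lebesgue2 (R : realType) :=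
  (@lebesgue_measure R \x @lebesgue_measure R)%E.

HB.instance Definition _ (R : realType) := Measure.on (@lebesgue2 R).

Lemma lebesgue2_sigma_finite (R : realType) : sigma_finite setT (@lebesgue2 R).
Proof.
have /sigma_finiteP[F [TF ndF Foo]] := sigma_finiteT (@lebesgue_measure R).
exists (fun n => F n `*` F n).
  rewrite -setXTT TF predeqE => -[x y]; split.
    move=> [/= [n _ Fnx] [k _ Fky]]; exists (maxn n k) => //; split.
    - by move: x Fnx; exact/subsetPset/ndF/leq_maxl.
    - by move: y Fky; exact/subsetPset/ndF/leq_maxr.
  by move=> [n _ []/= ? ?]; split; exists n.
move=> k; have [mF Fk] := Foo k.
split; first exact: measurableX.
by rewrite /lebesgue2 product_measure1E// lte_mul_pinfty// ge0_fin_numE.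
Qed.

HB.instance Definition _ (R : realType) :=
  Measure_isSigmaFinite.Build _ _ _ (@lebesgue2 R) (@lebesgue2_sigma_finite R).

(* Lebesgue measure on R * R * R *)
Definition lebesgue3 (R : realType) :=
  (@lebesgue2 R \x @lebesgue_measure R)%E.

HB.instance Definition _ (R : realType) := Measure.on (@lebesgue3 R).

(* f evaluated at Delta_j = c + i t_j, with t = ((t_1, t_2), t_3) *)
Definition on_lines (R : realType) (c : R) (f : R[i] -> R[i] -> R[i] -> R[i])
    (t : R * R * R) : R[i] :=
  f (c +i* t.1.1) (c +i* t.1.2) (c +i* t.2).

Definition lines_integrable (R : realType) (c : R)
    (f : R[i] -> R[i] -> R[i] -> R[i]) : Prop :=
  cintegrable (@lebesgue3 R) setT (on_lines c f).

(* (1 / (2 pi i))^3 times the integral of f over the three upward lines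
   Re Delta_j = c; the factor 'i ^+ 3 comes from d Delta_j = i d t_j. *)
Definition inv_mellin3 (R : realType) (c : R)
    (f : R[i] -> R[i] -> R[i] -> R[i]) : R[i] :=
  (1 / (2 * pi%:C * 'i)) ^+ 3
  * ('i ^+ 3 * cintegral (@lebesgue3 R) setT (on_lines c f)).

Definition kernelRK (R : realType) (M r12 r13 r23 w1 w2 w3 : R)
    (D1 D2 D3 : R[i]) : R[i] :=
  symbolR r12 r13 r23 D1 D2 D3 * kernelK M r12 r13 r23 w1 w2 w3 D1 D2 D3.

Definition calI0 (R : realType) (M r12 r13 r23 c : R) (w1 w2 w3 : R) : R[i] :=
  inv_mellin3 c (kernelK M r12 r13 r23 w1 w2 w3).

Definition calI1 (R : realType) (M r12 r13 r23 c : R) (w1 w2 w3 : R) : R[i] :=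
  inv_mellin3 c (kernelRK M r12 r13 r23 w1 w2 w3).

Definition eulerD (R : realType) (f : R -> R[i]) (x : R) : R[i] :=
  - x%:C * cderive f x.

Definition opD1 (R : realType) (F : R -> R -> R -> R[i]) (w1 w2 w3 : R) :=
  eulerD (fun x => F x w2 w3) w1.
Definition opD2 (R : realType) (F : R -> R -> R -> R[i]) (w1 w2 w3 : R) :=
  eulerD (fun x => F w1 x w3) w2.
Definition opD3 (R : realType) (F : R -> R -> R -> R[i]) (w1 w2 w3 : R) :=
  eulerD (fun x => F w1 w2 x) w3.

Definition partials_exist (R : realType) (F : R -> R -> R -> R[i])
    (w1 w2 w3 : R) : Prop :=
  [/\ cderivable (fun x => F x w2 w3) w1,
      cderivable (fun x => F w1 x w3) w2 &
      cderivable (fun x => F w1 w2 x) w3].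

(* D_i F and D_i^2 F exist at (w1, w2, w3), for i = 1, 2, 3 *)
Definition opO_defined (R : realType) (F : R -> R -> R -> R[i])
    (w1 w2 w3 : R) : Prop :=
  partials_exist F w1 w2 w3 /\
  [/\ cderivable (fun x => opD1 F x w2 w3) w1,
      cderivable (fun x => opD2 F w1 x w3) w2 &
      cderivable (fun x => opD3 F w1 w2 x) w3].

Definition opO (R : realType) (r12 r13 r23 : R) (F : R -> R -> R -> R[i])
    (w1 w2 w3 : R) : R[i] :=
  let f := F w1 w2 w3 in
  let d1 := opD1 F w1 w2 w3 in
  let d2 := opD2 F w1 w2 w3 in
  let d3 := opD3 F w1 w2 w3 in
  let d11 := opD1 (opD1 F) w1 w2 w3 in
  let d22 := opD2 (opD2 F) w1 w2 w3 in
  let d33 := opD3 (opD3 F) w1 w2 w3 in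
  1 / 4 *
    ((ln r12)%:C * (d11 + d22 - d33 + 4 * d3 - 5 * f)
     + (ln r13)%:C * (d11 + d33 - d22 - 4 * d3 + 3 * f)
     + (ln r23)%:C * (d33 + d22 - d11 - 4 * d3 + 3 * f))
  - (gammaE R)%:C * (d1 + d2 + d3 - f).

(* Main.v *)
Require Import Defs.
From mathcomp Require Import all_boot all_order all_algebra.
From mathcomp Require Import all_classical all_reals all_analysis.
From mathcomp Require Import complex measurable_realfun.
From mathcomp Require Import ring lra.
Import Order.TTheory GRing.Theory Num.Theory.
Import numFieldNormedType.Exports.
Local Open Scope ring_scope.

Set Implicit Arguments.
Unset Strict Implicit.
Unset Printing Implicit Defensive.
Local Open Scope classical_set_scope.
Local Open Scope complex_scope.
Local Notation Re := complex.Re.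
Local Notation Im := complex.Im.

(* On the line Re Delta_j = c the operator D_j multiplies the integrand by
   Delta_j, because D_j w_j ^ (- Delta_j) = Delta_j w_j ^ (- Delta_j); since O is
   the symbol R read in the D_j, everything reduces to differentiating twice
   under the integral sign.  Domination only needs polynomial decay of Gamma of
   arbitrary order on vertical lines, which follows from
   Gamma z = Gamma (z + n) / (z (z + 1) ... (z + n - 1)) and the
   boundedness of Gamma on vertical lines to the right of 0.  The imaginary parts y1, y2, y3 of the
   first three Gamma arguments are linear coordinates on R^3, so the decay of
   three Gamma factors already makes the kernel decay in all directions; the
   fourth factor is only bounded.  The conditions c <> 1/3 and c <> 1 keep the
   real parts (3 c - 1) / 2 and (c - 1) / 2 of the first three Gamma arguments
   away from the poles. *)

(** * Complex numbers by components *)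

(** The decay is budgeted against W = [lines_weight], the product of the three factors 1 + t_j^2.
    Its reciprocal is integrable on R^3, and on the lines each of the monomials 1, Delta_j,
    Delta_j^2 is at most a constant times W. The kernel is therefore bounded by a constant times
    W^-2: one factor absorbs the multiplier, the other makes the product integrable. Multipliers
    bounded by a constant times W are closed under linear combinations, and D_j turns the integral
    with multiplier P into the one with multiplier Delta_j P, so the theorem ends as a linear
    identity between seven integrals. Because integrals and derivatives are taken by components,
    each analytic fact would have to be proved twice. Instead it is proved for real parts with an
    arbitrary complex factor inside; imaginary parts follow from Im w = Re (- i w). *)

Section complex_modulus.
Variable R : realType.
Implicit Types (a x : R) (w z : R[i]).

(** The norm of [R[i]] has values in [R[i]]; estimates need a modulus with values in [R]. *)
Definition cabs z : R := Normc.normc z.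

Lemma cReM w z : Re (w * z) = Re w * Re z - Im w * Im z.
Proof. by case: w z => [? ?] [? ?]. Qed.

Lemma cImM w z : Im (w * z) = Re w * Im z + Im w * Re z.
Proof. by case: w z => [? ?] [? ?]. Qed.

Lemma cReD w z : Re (w + z) = Re w + Re z.
Proof. by case: w z => [? ?] [? ?]. Qed.

Lemma cImD w z : Im (w + z) = Im w + Im z.
Proof. by case: w z => [? ?] [? ?]. Qed.

Lemma cReN z : Re (- z) = - Re z.
Proof. by case: z. Qed.

Lemma cImN z : Im (- z) = - Im z.
Proof. by case: z. Qed.

Lemma cReV z : Re z^-1 = Re z / (Re z ^+ 2 + Im z ^+ 2).
Proof. by case: z. Qed.

Lemma cImV z : Im z^-1 = - Im z / (Re z ^+ 2 + Im z ^+ 2).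
Proof. by case: z => a b; rewrite mulNr. Qed.

Lemma complex_ext w z : Re w = Re z -> Im w = Im z -> w = z.
Proof. by case: w z => [? ?] [? ?] /= -> ->. Qed.

Lemma sqr_cabs z : cabs z ^+ 2 = Re z ^+ 2 + Im z ^+ 2.
Proof. by case: z => a b; rewrite /cabs /= sqr_sqrtr // addr_ge0 ?sqr_ge0. Qed.

Lemma cabs_ge0 z : 0 <= cabs z.
Proof. by case: z => a b; exact: sqrtr_ge0. Qed.

Lemma cabsM w z : cabs (w * z) = cabs w * cabs z.
Proof. exact: Normc.normcM. Qed.

Lemma cabsV z : cabs z^-1 = (cabs z)^-1.
Proof. exact: Normc.normcV. Qed.

Lemma cabsD_le w z : cabs (w + z) <= cabs w + cabs z.
Proof. exact: le_normcD. Qed.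

Lemma cabsN z : cabs (- z) = cabs z.
Proof. exact: normcN. Qed.

Lemma cabs_real x : cabs x%:C = `|x|.
Proof. by rewrite /cabs /= expr0n /= addr0 sqrtr_sqr. Qed.

Lemma cabs_gt0 z : z != 0 -> 0 < cabs z.
Proof.
move=> z0; rewrite lt_neqAle cabs_ge0 andbT eq_sym.
by apply: contra z0 => /eqP/Normc.eq0_normc ->.
Qed.

Lemma normr_Re_le z : `|Re z| <= cabs z.
Proof.
by rewrite -(ler_sqr (normr_ge0 _) (cabs_ge0 _)) real_normK ?num_real//
  sqr_cabs lerDl sqr_ge0.
Qed.

Lemma normr_Im_le z : `|Im z| <= cabs z.
Proof.
by rewrite -(ler_sqr (normr_ge0 _) (cabs_ge0 _)) real_normK ?num_real//
  sqr_cabs lerDr sqr_ge0.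
Qed.

Lemma cabs_le_ReIm z : cabs z <= `|Re z| + `|Im z|.
Proof.
rewrite -(ler_sqr (cabs_ge0 _) (addr_ge0 (normr_ge0 _) (normr_ge0 _))) sqr_cabs.
rewrite sqrrD !real_normK ?num_real// addrAC lerDl.
by rewrite mulrn_wge0// mulr_ge0.
Qed.

Lemma Re_cexp z : Re (cexp z) = expR (Re z) * cos (Im z).
Proof. by rewrite /cexp cReM /= mul0r subr0. Qed.

Lemma Im_cexp z : Im (cexp z) = expR (Re z) * sin (Im z).
Proof. by rewrite /cexp cImM /= mul0r addr0. Qed.

Lemma cabs_cexp z : cabs (cexp z) = expR (Re z).
Proof.
apply/eqP; rewrite -(eqrXn2 (n := 2))// ?cabs_ge0 ?expR_ge0// sqr_cabs.
by rewrite Re_cexp Im_cexp !exprMn -mulrDr cos2Dsin2 mulr1.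
Qed.

Lemma cexpD w z : cexp (w + z) = cexp w * cexp z.
Proof.
apply: complex_ext.
  by rewrite [RHS]cReM !Re_cexp !Im_cexp cReD cImD expRD cosD; ring.
by rewrite [RHS]cImM !Re_cexp !Im_cexp cReD cImD expRD sinD; ring.
Qed.

Lemma cexp0 : cexp 0 = 1 :> R[i].
Proof.
apply: complex_ext.
  by rewrite Re_cexp /= expR0 cos0 mul1r.
by rewrite Im_cexp /= expR0 sin0 mul1r.
Qed.

Lemma Re_cpow_arg a z : Re ((ln a)%:C * z) = ln a * Re z.
Proof. by rewrite cReM /= mul0r subr0. Qed.

Lemma Im_cpow_arg a z : Im ((ln a)%:C * z) = ln a * Im z.
Proof. by rewrite cImM /= mul0r addr0. Qed.

Lemma Re_cpow a z : Re (cpow a z) = expR (ln a * Re z) * cos (ln a * Im z).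
Proof. by rewrite Re_cexp Re_cpow_arg Im_cpow_arg. Qed.

Lemma Im_cpow a z : Im (cpow a z) = expR (ln a * Re z) * sin (ln a * Im z).
Proof. by rewrite Im_cexp Re_cpow_arg Im_cpow_arg. Qed.

Lemma cabs_cpow a z : cabs (cpow a z) = expR (ln a * Re z).
Proof. by rewrite cabs_cexp Re_cpow_arg. Qed.

Lemma cpowD a w z : cpow a (w + z) = cpow a w * cpow a z.
Proof. by rewrite /cpow mulrDr cexpD. Qed.

Lemma cpow1 z : cpow 1 z = 1 :> R[i].
Proof. by rewrite /cpow ln1 mul0r cexp0. Qed.

End complex_modulus.

(** Eleven is the number of factors of [kernelK]. *)
Lemma cabs_prod11 (R : realType) (a1 a2 a3 a4 a5 a6 a7 a8 a9 b1 b2 : R[i]) :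
  cabs (a1 * a2 * a3 * a4 * a5 * a6 * a7 * a8 * a9 * b1 * b2) =
  cabs a1 * cabs a2 * cabs a3 * cabs a4 * cabs a5 * cabs a6 * cabs a7 *
  cabs a8 * cabs a9 * cabs b1 * cabs b2.
Proof. by rewrite !cabsM. Qed.

(** * Measurability of complex-valued functions *)

Section complex_measurable.
Context d (T : measurableType d) (R : realType).
Implicit Types f g : T -> R[i].

Definition cmeasurable f :=
  measurable_fun setT (fun t => Re (f t)) /\
  measurable_fun setT (fun t => Im (f t)).

Lemma cmeasurable_cst z : cmeasurable (fun=> z).
Proof. by split; exact: measurable_cst. Qed.

Lemma cmeasurable_Complex (u v : T -> R) : measurable_fun setT u ->
  measurable_fun setT v -> cmeasurable (fun t => u t +i* v t).
Proof. by []. Qed.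

Lemma cmeasurableD f g : cmeasurable f -> cmeasurable g ->
  cmeasurable (fun t => f t + g t).
Proof.
move=> [f1 f2] [g1 g2]; split.
  by under eq_fun do rewrite cReD; exact: measurable_funD.
by under eq_fun do rewrite cImD; exact: measurable_funD.
Qed.

Lemma cmeasurableM f g : cmeasurable f -> cmeasurable g ->
  cmeasurable (fun t => f t * g t).
Proof.
move=> [f1 f2] [g1 g2]; split.
  by under eq_fun do rewrite cReM; apply: measurable_funB; exact: measurable_funM.
by under eq_fun do rewrite cImM; apply: measurable_funD; exact: measurable_funM.
Qed.

Lemma cmeasurableN f : cmeasurable f -> cmeasurable (fun t => - f t).
Proof.
move=> [f1 f2]; split.
  by under eq_fun do rewrite cReN; exact: measurableT_comp.
by under eq_fun do rewrite cImN; exact: measurableT_comp.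
Qed.

Lemma measurable_fun_inv (u : T -> R) : measurable_fun setT u ->
  (forall t, 0 < u t) -> measurable_fun setT (fun t => (u t)^-1).
Proof.
move=> mu u0.
rewrite (_ : (fun t => (u t)^-1) = (fun t => expR (- ln (u t)))); last first.
  by apply/funext => t; rewrite expRN lnK// posrE.
by apply: measurableT_comp => //; apply: measurableT_comp => //;
  apply: measurableT_comp.
Qed.

Lemma cmeasurableV f : cmeasurable f -> (forall t, f t != 0) ->
  cmeasurable (fun t => (f t)^-1).
Proof.
move=> [f1 f2] f0.
have m2 : measurable_fun setT (fun t => (Re (f t) ^+ 2 + Im (f t) ^+ 2)^-1).
  apply: measurable_fun_inv.
    by apply: measurable_funD; exact: measurable_funX.
  by move=> t; rewrite -sqr_cabs exprn_gt0// cabs_gt0.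
split.
  by under eq_fun do rewrite cReV; exact: measurable_funM.
under eq_fun do rewrite cImV; apply: measurable_funM => //.
exact: measurableT_comp.
Qed.

Lemma cmeasurable_cpow a f : cmeasurable f ->
  cmeasurable (fun t => cpow a (f t)).
Proof.
move=> [f1 f2]; split.
  under eq_fun do rewrite Re_cpow; apply: measurable_funM => //.
    by apply: measurableT_comp => //; exact: measurable_funM.
  apply: measurableT_comp; last exact: measurable_funM.
  by apply: continuous_measurable_fun; exact: continuous_cos.
under eq_fun do rewrite Im_cpow; apply: measurable_funM => //.
  by apply: measurableT_comp => //; exact: measurable_funM.
apply: measurableT_comp; last exact: measurable_funM.
by apply: continuous_measurable_fun; exact: continuous_sin.
Qed.

End complex_measurable.

Lemma le_integrable_EFin d (T : measurableType d) (R : realType)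
    (mu : {measure set T -> \bar R}) (D : set T) (f g : T -> R) :
  measurable D -> measurable_fun D f -> (forall t, D t -> `|f t| <= g t) ->
  mu.-integrable D (EFin \o g) -> mu.-integrable D (fun t => (f t)%:E).
Proof.
move=> mD mf fg ig; apply: (le_integrable mD _ _ ig).
  exact/measurable_EFinP.
by move=> t Dt; rewrite /= lee_fin (le_trans (fg t Dt))// ler_norm.
Qed.

Lemma cmeasurable_comp d (T : measurableType d) (R : realType)
    (f : R -> R[i]) (y : T -> R) :
  cmeasurable f -> measurable_fun setT y -> cmeasurable (fun t => f (y t)).
Proof.
move=> [f1 f2] my.
by split; [exact: (measurableT_comp f1 my)|exact: (measurableT_comp f2 my)].
Qed.

(** * Linearity and domination for the componentwise integral *)

Section complex_integral.
Context d (T : measurableType d) (R : realType) (mu : {measure set T -> \bar R}).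
Implicit Types (f g : T -> R[i]) (G : T -> R).

Lemma cintegrable_dominated f G : cmeasurable f ->
  mu.-integrable setT (EFin \o G) -> (forall t, cabs (f t) <= G t) ->
  cintegrable mu setT f.
Proof.
move=> [f1 f2] iG fG; split.
  apply: (le_integrable _ _ _ iG) => //; first exact/measurable_EFinP.
  move=> t _ /=; rewrite lee_fin (le_trans (normr_Re_le _))//.
  by rewrite (le_trans (fG t))// ler_norm.
apply: (le_integrable _ _ _ iG) => //; first exact/measurable_EFinP.
move=> t _ /=; rewrite lee_fin (le_trans (normr_Im_le _))//.
by rewrite (le_trans (fG t))// ler_norm.
Qed.

Variables (D : set T) (mD : measurable D).

Lemma cintegralD f g : cintegrable mu D f -> cintegrable mu D g ->
  cintegral mu D (fun t => f t + g t) = cintegral mu D f + cintegral mu D g.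
Proof.
move=> [f1 f2] [g1 g2]; apply: complex_ext.
  by rewrite cReD -RintegralD//; apply: eq_Rintegral => t _; rewrite cReD.
by rewrite cImD -RintegralD//; apply: eq_Rintegral => t _; rewrite cImD.
Qed.

Let integrableM_cst (a : R) (u : T -> R) :
  mu.-integrable D (fun t => (u t)%:E) ->
  mu.-integrable D (fun t => (a * u t)%:E).
Proof. by move=> iu; under eq_fun do rewrite EFinM; exact: integrableZl. Qed.

Lemma cintegralZ z f : cintegrable mu D f ->
  cintegral mu D (fun t => z * f t) = z * cintegral mu D f.
Proof.
move=> [f1 f2]; apply: complex_ext.
  rewrite cReM /= -!RintegralZl// -RintegralB//; [|exact: integrableM_cst..].
  by apply: eq_Rintegral => t _; rewrite cReM.
rewrite cImM /= -!RintegralZl// -RintegralD//; [|exact: integrableM_cst..].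
by apply: eq_Rintegral => t _; rewrite cImM.
Qed.

Lemma cintegrableZ z f : cintegrable mu D f ->
  cintegrable mu D (fun t => z * f t).
Proof.
move=> [f1 f2]; split.
  rewrite (_ : (fun _ => _) = (fun t => (Re z * Re (f t))%:E) \-
                              (fun t => (Im z * Im (f t))%:E))%E.
    by apply: integrableB => //; exact: integrableM_cst.
  by apply/funext => t; rewrite cReM EFinB.
rewrite (_ : (fun _ => _) = (fun t => (Re z * Im (f t))%:E) \+
                            (fun t => (Im z * Re (f t))%:E))%E.
  by apply: integrableD => //; exact: integrableM_cst.
by apply/funext => t; rewrite cImM EFinD.
Qed.

Lemma cintegrableD f g : cintegrable mu D f -> cintegrable mu D g ->
  cintegrable mu D (fun t => f t + g t).
Proof.
move=> [f1 f2] [g1 g2]; split.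
  under eq_fun do rewrite cReD EFinD; exact: integrableD.
under eq_fun do rewrite cImD EFinD; exact: integrableD.
Qed.

End complex_integral.

(** * Differentiation under a Mellin integral *)

Section mellin_derivative.
Variable R : realType.

(** The factor [k] makes this one real statement cover both components of u^z, through [k] = 1 and
    [k] = - i. *)
Lemma is_derive_Re_cpow (x : R) (z k : R[i]) : 0 < x ->
  is_derive x 1 (fun u => Re (cpow u z * k)) (x^-1 * Re (cpow x z * (z * k))).
Proof.
move=> x0.
(* In the variable s = ln u the function is the real part of e^(s z) k; the factor [x^-1] then comes
   from the chain rule. *)
pose E (s : R) := expR (s * Re z) *
  (cos (s * Im z) * Re k - sin (s * Im z) * Im k).
have -> : (fun u => Re (cpow u z * k)) = E \o (@ln R).
  by apply/funext => u; rewrite /E /= cReM Re_cpow Im_cpow; ring.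
have dM (s a : R) : is_derive s 1 (fun s : R => s * a) a.
  by apply: is_derive_eq; rewrite scaler0 add0r /GRing.scale/= mulr1.
have dE (s : R) : is_derive s 1 E (expR (s * Re z) *
    (Re z * (cos (s * Im z) * Re k - sin (s * Im z) * Im k) -
     Im z * (sin (s * Im z) * Re k + cos (s * Im z) * Im k))).
  have d1 : is_derive s 1 (expR \o (fun s : R => s * Re z)) (expR (s * Re z) * Re z).
    exact: is_derive1_comp.
  have d2 : is_derive s 1 (cos \o (fun s : R => s * Im z)) (- sin (s * Im z) * Im z).
    exact: is_derive1_comp.
  have d3 : is_derive s 1 (sin \o (fun s : R => s * Im z)) (cos (s * Im z) * Im z).
    exact: is_derive1_comp.
  have dC (a : R) : is_derive s 1 (cst a) 0 := is_derive_cst a s 1.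
  have d4 := is_deriveM d1 (is_deriveB (is_deriveM d2 (dC (Re k)))
     (is_deriveM d3 (dC (Im k)))).
  apply: (is_derive_eq d4).
  by rewrite !scaler0 /GRing.scale/= !fctE /=; ring.
apply: (is_derive_eq (is_derive1_comp (dE (ln x)) (is_derive1_ln x0))).
rewrite mulrC; congr *%R.
by rewrite cReM Re_cpow Im_cpow cReM cImM; ring.
Qed.

Context d (T : measurableType d) (mu : {measure set T -> \bar R}).
Variables (D : T -> R[i]) (c : R) (G : T -> R).
Hypothesis c_ge0 : 0 <= c.
Hypothesis ReDE : forall t, Re (D t) = c.
Hypothesis mD : cmeasurable D.
Hypothesis iG : mu.-integrable setT (EFin \o G).

(** The modulus does not depend on [t], so on the line the power leaves every domination as a
    constant. *)
Lemma cabs_cpow_oppD (x : R) t : cabs (cpow x (- D t)) = expR (- (ln x * c)).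
Proof. by rewrite cabs_cpow cReN ReDE mulrN. Qed.

Lemma cintegrable_mellin (h : T -> R[i]) (x : R) : cmeasurable h ->
  (forall t, cabs (h t) <= G t) ->
  cintegrable mu setT (fun t => cpow x (- D t) * h t).
Proof.
move=> mh hG.
apply: (@cintegrable_dominated _ _ _ _ _ (fun t => expR (- (ln x * c)) * G t)).
- by apply: cmeasurableM => //; apply: cmeasurable_cpow; exact: cmeasurableN.
- rewrite (_ : _ \o _ = fun t => (expR (- (ln x * c)))%:E * (G t)%:E)%E.
    exact: integrableZl.
  by apply/funext => t /=; rewrite EFinM.
- by move=> t; rewrite cabsM cabs_cpow_oppD ler_wpM2l ?expR_ge0.
Qed.

Lemma is_derive_Re_mellin (h : T -> R[i]) (x : R) : 0 < x -> cmeasurable h ->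
  (forall t, cabs (h t) <= G t) -> (forall t, cabs (D t * h t) <= G t) ->
  is_derive x 1
    (fun u => Rintegral mu setT (fun t => Re (cpow u (- D t) * h t)))
    (- x^-1 * Rintegral mu setT (fun t => Re (cpow x (- D t) * (D t * h t)))).
Proof.
move=> x0 mh hG DhG.
have mDh : cmeasurable (fun t => D t * h t) by exact: cmeasurableM.
pose f (u : R) t := Re (cpow u (- D t) * h t).
have df (u : R) t : 0 < u ->
    partial1of2 f u t = - u^-1 * Re (cpow u (- D t) * (D t * h t)).
  move=> u0; have dfu := is_derive_Re_cpow (- D t) (h t) u0.
  by rewrite partial1of2E derive_val mulNr mulrN cReN mulrN mulNr.
have x2 : 0 < x / 2 by rewrite divr_gt0.
have G0 t : 0 <= G t := le_trans (cabs_ge0 _) (hG t).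
(* For u > x / 2 both u^-1 and u^-c are bounded by their values at x / 2, the second because c >= 0;
   [K] is the product of these values. *)
pose K := (x / 2)^-1 * expR (- (ln (x / 2) * c)).
have K0 : 0 <= K by rewrite mulr_ge0 ?expR_ge0// invr_ge0 ltW.
have iKG : mu.-integrable setT (EFin \o (fun t => K * G t)).
  rewrite (_ : _ \o _ = fun t => K%:E * (G t)%:E)%E; first exact: integrableZl.
  by apply/funext => t /=; rewrite EFinM.
have := @cvg_differentiation_under_integral R _ _ mu f setT measurableT
  x (x / 2) (2 * x) _ _ _ (fun t => K * G t) _ iKG _.
have -> : Rintegral mu setT (partial1of2 f x) =
   - x^-1 * Rintegral mu setT (fun t => Re (cpow x (- D t) * (D t * h t))).
  rewrite -RintegralZl//; last by have [] := cintegrable_mellin x mDh DhG.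
  by apply: eq_Rintegral => t _; exact: df.
move=> cv.
have {cv} : (h0^-1 *: (Rintegral mu setT (f (h0 + x)) - Rintegral mu setT (f x)))
    @[h0 --> 0^'] -->
   - x^-1 * Rintegral mu setT (fun t => Re (cpow x (- D t) * (D t * h t))).
  apply: cv.
  - by rewrite /= in_itv /=; apply/andP; split; lra.
  - by move=> u _; have [] := cintegrable_mellin u mh hG.
  - move=> u t; rewrite /= in_itv /= => /andP[u1 _] _.
    have dfu := is_derive_Re_cpow (- D t) (h t) (lt_trans x2 u1).
    exact: ex_derive.
  - by move=> t; rewrite mulr_ge0.
  - move=> u t; rewrite /= in_itv /= => /andP[u1 _] _.
    have u0 := lt_trans x2 u1.
    rewrite [partial1of2 f u t]df// normrM normrN.
    rewrite (le_trans (ler_wpM2l (normr_ge0 _) (normr_Re_le _)))//.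
    rewrite cabsM cabs_cpow_oppD gtr0_norm ?invr_gt0// mulrA.
    rewrite ler_pM ?cabs_ge0// ?mulr_ge0 ?expR_ge0 ?invr_ge0 ?(ltW u0)//.
    rewrite ler_pM ?expR_ge0 ?invr_ge0 ?(ltW u0)//.
      by rewrite lef_pV2 ?posrE// ltW.
    by rewrite ler_expR lerN2 ler_wpM2r// ler_ln ?posrE// ltW.
move=> cv; apply: DeriveDef.
  apply/cvg_ex; eexists => /=.
  under eq_fun do rewrite scaler1.
  exact: cv.
by rewrite -derive1E; apply/cvg_lim => //; exact: cv.
Qed.

Definition mellin (h : T -> R[i]) (x : R) : R[i] :=
  cintegral mu setT (fun t => cpow x (- D t) * h t).

Lemma cderive_mellin (h : T -> R[i]) (x : R) : 0 < x -> cmeasurable h ->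
  (forall t, cabs (h t) <= G t) -> (forall t, cabs (D t * h t) <= G t) ->
  cderivable (mellin h) x /\
  eulerD (mellin h) x = mellin (fun t => D t * h t) x.
Proof.
move=> x0 mh hG DhG.
(* The imaginary part is the real part for [h] multiplied by - i, which has the same modulus and
   hence the same dominating function. *)
have ImE (w : R[i]) : Im w = Re (w * - 'i) by rewrite cReM /=; ring.
have dRe := is_derive_Re_mellin x0 mh hG DhG.
pose h' t := h t * - 'i.
have ci z : cabs (z * - 'i) = cabs z.
  by rewrite cabsM cabsN /cabs /= expr0n /= add0r expr1n sqrtr1 mulr1.
have dIm : is_derive x 1
    (fun u => Rintegral mu setT (fun t => Im (cpow u (- D t) * h t)))
    (- x^-1 * Rintegral mu setT (fun t => Im (cpow x (- D t) * (D t * h t)))).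
  have -> : (fun u => Rintegral mu setT (fun t => Im (cpow u (- D t) * h t))) =
      (fun u => Rintegral mu setT (fun t => Re (cpow u (- D t) * h' t))).
    by apply/funext => u; apply: eq_Rintegral => t _; rewrite ImE -mulrA.
  have -> : Rintegral mu setT (fun t => Im (cpow x (- D t) * (D t * h t))) =
      Rintegral mu setT (fun t => Re (cpow x (- D t) * (D t * h' t))).
    by apply: eq_Rintegral => t _; rewrite ImE -!mulrA.
  apply: is_derive_Re_mellin => //.
  - by apply: cmeasurableM => //; exact: cmeasurable_cst.
  - by move=> t; rewrite ci.
  - by move=> t; rewrite mulrA ci.
split; first by split; exact: ex_derive.
rewrite /eulerD /cderive !derive1E /=.
have -> : 'D_1 (fun u => Re (mellin h u)) x =
    - x^-1 * Rintegral mu setT (fun t => Re (cpow x (- D t) * (D t * h t))).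
  exact: derive_val.
have -> : 'D_1 (fun u => Im (mellin h u)) x =
    - x^-1 * Rintegral mu setT (fun t => Im (cpow x (- D t) * (D t * h t))).
  exact: derive_val.
have x1 : x != 0 by rewrite gt_eqF.
by apply: complex_ext => /=; field.
Qed.

End mellin_derivative.

(** * Gamma on vertical lines *)

Section half_line_FTC.
Variable R : realType.
Local Notation mu := (@lebesgue_measure R).
Implicit Types f F : R -> R.

(** The endpoints are symmetric in ln x, and [n.+1] keeps the interval nondegenerate at n = 0. *)
Definition exhaust (n : nat) : set R := `[expR (- n.+1%:R), expR n.+1%:R]%classic.

Lemma exhaust_lt n : expR (- n.+1%:R) < expR n.+1%:R :> R.
Proof. by rewrite ltr_expR gtrN// ltr0Sn. Qed.

Lemma exhaust_nondecreasing : nondecreasing_seq exhaust.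
Proof.
move=> m n mn; apply/subsetPset => x; rewrite /exhaust /= !in_itv /=.
have mnR : m.+1%:R <= n.+1%:R :> R by rewrite ler_nat ltnS.
move=> /andP[mx xm]; apply/andP; split.
  by rewrite (le_trans _ mx)// ler_expR lerN2.
by rewrite (le_trans xm)// ler_expR.
Qed.

Lemma exhaust_gt0 n x : exhaust n x -> 0 < x.
Proof.
by rewrite /exhaust /= in_itv/= => /andP[+ _]; apply: lt_le_trans; exact: expR_gt0.
Qed.

Lemma mem_exhaust (x : R) : 0 < x -> exists n, exhaust n x.
Proof.
move=> x0; exists (Num.truncn `|ln x|).
have := truncnS_gt `|ln x|; set n := _.+1 => /ltW; rewrite ler_norml => /andP[l u].
rewrite /exhaust /= in_itv/=; apply/andP; split.
  by rewrite -[leRHS]lnK ?posrE// ler_expR.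
by rewrite -[leLHS]lnK ?posrE// ler_expR.
Qed.

Lemma bigcup_exhaust : \bigcup_n exhaust n = `]0, +oo[%classic.
Proof.
apply/seteqP; split => x /=.
  by move=> [n _ /exhaust_gt0 x0]; rewrite in_itv/= x0.
by rewrite in_itv/= andbT => /mem_exhaust[n nx]; exists n.
Qed.

Lemma measurable_pos_continuous f : (forall x : R, 0 < x -> {for x, continuous f}) ->
  measurable_fun (`]0, +oo[%classic : set R) f.
Proof.
move=> cf; apply: open_continuous_measurable_fun; first exact: interval_open.
by move=> x; rewrite inE/= in_itv/= andbT; exact: cf.
Qed.

Lemma integral_exhaust F f n : (forall x : R, 0 < x -> is_derive x 1 F (f x)) ->
  (forall x : R, 0 < x -> {for x, continuous f}) ->
  (\int[mu]_(x in exhaust n) (f x)%:E =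
    (F (expR n.+1%:R))%:E - (F (expR (- n.+1%:R)))%:E)%E.
Proof.
move=> dF cf; apply: continuous_FTC2.
- exact: exhaust_lt.
- apply: continuous_in_subspaceT => x /set_mem; exact: (fun h => cf _ (@exhaust_gt0 n x h)).
- have cF (x : R) : 0 < x -> {for x, continuous F}.
    move=> x0; apply: differentiable_continuous; apply/derivable1_diffP.
    by have dFx := dF x x0; exact: ex_derive.
  split.
  + move=> x; rewrite in_itv/= => /andP[x1 _].
    by have dFx := dF x (lt_trans (expR_gt0 _) x1); exact: ex_derive.
  + by apply: cvg_at_right_filter; apply: cF; exact: expR_gt0.
  + by apply: cvg_at_left_filter; apply: cF; exact: expR_gt0.
- move=> x; rewrite in_itv/= => /andP[x1 _].
  have := dF x (lt_trans (expR_gt0 _) x1) => dFx.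
  by rewrite derive1E derive_val.
Qed.

(** By monotone convergence: the integrals over [exhaust n] are increments of [F], hence at most
    [B + B]. *)
Lemma integrable_bounded_primitive F f (B : R) :
  (forall x : R, 0 < x -> is_derive x 1 F (f x)) ->
  (forall x : R, 0 < x -> {for x, continuous f}) ->
  (forall x : R, 0 < x -> 0 <= f x) -> (forall x : R, 0 < x -> `|F x| <= B) ->
  mu.-integrable `]0, +oo[ (EFin \o f).
Proof.
move=> dF cf f0 FB; apply/integrableP; split.
  by apply/measurable_EFinP; exact: measurable_pos_continuous.
have -> : (\int[mu]_(x in `]0%R, +oo[) `|(EFin \o f) x| =
           \int[mu]_(x in \bigcup_n exhaust n) (f x)%:E)%E.
  rewrite bigcup_exhaust; apply: eq_integral => x.
  by rewrite inE/= in_itv/= andbT => x0; rewrite ger0_norm// f0.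
have cv : (\int[mu]_(x in exhaust i) (f x)%:E @[i --> \oo] -->
    \int[mu]_(x in \bigcup_i exhaust i) (f x)%:E)%E.
  apply: ge0_nondecreasing_set_cvg_integral.
  - exact: exhaust_nondecreasing.
  - by move=> n; exact: measurable_itv.
  - move=> n; apply: (measurable_funS (E := (`]0, +oo[%classic : set R))) => //.
      by move=> x /= /exhaust_gt0 x0; rewrite in_itv/= x0.
    by apply/measurable_EFinP; exact: measurable_pos_continuous.
  - by move=> n x /exhaust_gt0 x0; rewrite lee_fin f0.
apply: (@le_lt_trans _ _ (B + B)%:E); last exact: ltry.
rewrite -(cvg_lim _ cv)//; apply: lime_le; first by apply/cvg_ex; eexists; exact: cv.
apply: nearW => n; rewrite (integral_exhaust n dF cf) -EFinB lee_fin.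
by rewrite (le_trans (ler_norm _))// (le_trans (ler_normB _ _))// lerD// FB ?expR_gt0.
Qed.

(** The integrand may oscillate, so the truncations to [exhaust n] converge by domination, with |f|
    as the dominating function. *)
Lemma Rintegral_pos_derivative F f (a b : R) :
  (forall x : R, 0 < x -> is_derive x 1 F (f x)) ->
  (forall x : R, 0 < x -> {for x, continuous f}) ->
  mu.-integrable `]0, +oo[ (EFin \o f) ->
  F (expR (- n.+1%:R)) @[n --> \oo] --> a ->
  F (expR n.+1%:R) @[n --> \oo] --> b ->
  Rintegral mu `]0, +oo[ f = b - a.
Proof.
move=> dF cf iff Fa Fb.
pose f_ n x := ((EFin \o f) \_ (exhaust n)) x.
have mexh n : measurable (exhaust n) by exact: measurable_itv.
have sub n : exhaust n `<=` `]0, +oo[%classic.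
  by move=> x /= /exhaust_gt0 x0; rewrite in_itv/= x0.
have cv : (\int[mu]_(x in `]0%R, +oo[) f_ n x @[n --> \oo] -->
    \int[mu]_(x in `]0%R, +oo[) (f x)%:E)%E.
  apply: (@dominated_cvg _ _ _ mu _ _ f_ (EFin \o f) (abse \o (EFin \o f))) => //.
  - move=> n; apply: measurable_funTS.
    apply/(measurable_restrictT _ (mexh n)).
    apply: (measurable_funS (E := (`]0, +oo[%classic : set R))) => //.
    by apply/measurable_EFinP; exact: measurable_pos_continuous.
  - move=> x; rewrite /= in_itv/= andbT => /mem_exhaust[N Nx].
    apply: cvg_near_cst; exists N => // n /= Nn.
    have /subsetPset s := exhaust_nondecreasing Nn.
    by rewrite /f_ patchE mem_set//; exact: s.
  - exact: integrable_abse.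
  - by move=> n x _; rewrite /f_ patchE; case: ifP => //; rewrite abse0 abse_ge0.
have e n : (\int[mu]_(x in `]0%R, +oo[) f_ n x =
    (F (expR n.+1%:R) - F (expR (- n.+1%:R)))%:E)%E.
  rewrite EFinB -(integral_exhaust n dF cf) /f_ -integral_mkcondr setIC.
  by rewrite setIidl.
have cv2 : ((F (expR n.+1%:R) - F (expR (- n.+1%:R)))%:E @[n --> \oo] -->
    (b - a)%:E)%E by apply: cvg_EFin; [exact: nearW|exact: cvgB].
move: cv; under eq_fun do rewrite e.
by move=> cv; rewrite /Rintegral -(cvg_lim _ cv)// (cvg_lim _ cv2).
Qed.

End half_line_FTC.

(** * Integrability of Euler's integrand *)

Section euler_integrand.
Variable R : realType.
Local Notation mu := (@lebesgue_measure R).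
Local Notation pos := (`]0, +oo[%classic : set R).
Implicit Types (s t x y : R) (z k : R[i]).

(** The inequality ln x <= x - 1 at x = t / s, multiplied by s. *)
Lemma mul_ln_le s t : 0 < s -> 0 < t -> s * ln t <= t + (s * ln s - s).
Proof.
move=> s0 t0; have ts : 0 < t / s by rewrite divr_gt0.
have : ln (t / s) <= t / s - 1.
  by rewrite -[X in ln X](subrK 1) addrC le_ln1Dx// ltrBrDl addrN.
rewrite ln_div ?posrE// => /(ler_wpM2l (ltW s0)).
rewrite !mulrBr mulrCA divff ?gt_eqF// mulr1; lra.
Qed.

(* The maximum of t ^ s e ^ -t over t > 0, attained at t = s. *)
Definition gamma_bound s : R := expR (s * ln s - s).

Lemma expR_mul_ln_le s t : 0 < s -> 0 < t ->
  expR (s * ln t) * expR (- t) <= gamma_bound s.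
Proof.
move=> s0 t0; rewrite -expRD ler_expR; have := mul_ln_le s0 t0; lra.
Qed.

Definition gamma_weight s t : R := expR (ln t * (s - 1)) * expR (- t).

Lemma gamma_weight_ge0 s t : 0 <= gamma_weight s t.
Proof. by rewrite mulr_ge0 ?expR_ge0. Qed.

Lemma expR_mulN_ln s t : 0 < t -> expR (ln t * (s - 1)) = expR (s * ln t) / t.
Proof.
move=> t0; rewrite mulrBr mulr1 expRD expRN lnK ?posrE//; congr (expR _ * _).
exact: mulrC.
Qed.

Lemma measurable_gamma_weight s : measurable_fun pos (gamma_weight s).
Proof.
apply: measurable_funTS; apply: measurable_funM => //.
  by apply: measurableT_comp => //; exact: measurable_funM.
by apply: measurableT_comp => //; exact: measurableT_comp.
Qed.

(* The weight is dominated by a multiple of the derivative of atan (t ^ s). *)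
Lemma integrable_gamma_weight s : 0 < s ->
  mu.-integrable pos (EFin \o gamma_weight s).
Proof.
move=> s0.
have s20 : 0 < 2 * s by rewrite mulr_gt0.
(* [K] bounds e^-t (1 + t^(2s)): the first term is at most 1, the second at most
   [gamma_bound (2 * s)]. Hence the weight is at most [f], the derivative of the bounded function
   [F]. *)
pose K : R := 1 + gamma_bound (2 * s).
have K0 : 0 < K by rewrite addr_gt0// expR_gt0.
pose f t : R := K * (t^-1 * expR (s * ln t)) / (1 + expR (s * ln t) ^+ 2).
pose F t : R := K / s * atan (expR (s * ln t)).
have cE t : 0 < t -> {for t, continuous (fun t => expR (s * ln t))}.
  move=> t0; apply: continuous_comp; last exact: continuous_expR.
  by apply: continuousM; [exact: cst_continuous|exact: continuous_ln].
have d0 t : 1 + expR (s * ln t) ^+ 2 != 0.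
  by rewrite gt_eqF// ltr_pwDl// sqr_ge0.
have iff : mu.-integrable pos (EFin \o f).
  apply: (@integrable_bounded_primitive _ F f (K / s * (pi / 2))).
  - move=> t t0.
    have d1 := is_derive1_ln t0.
    have d2 : is_derive t 1 (fun t : R => s * ln t) (s * t^-1).
      apply: (is_derive_eq (is_deriveM (is_derive_cst s t 1) d1)).
      by rewrite scaler0 addr0 /GRing.scale/= .
    have d3 : is_derive t 1 (expR \o (fun t => s * ln t)) (expR (s * ln t) * (s * t^-1)).
      exact: is_derive1_comp.
    have d4 : is_derive t 1 (atan \o (expR \o (fun t => s * ln t)))
      ((1 + expR (s * ln t) ^+ 2)^-1 * (expR (s * ln t) * (s * t^-1))).
      exact: is_derive1_comp.
    apply: (is_derive_eq (is_deriveM (is_derive_cst (K / s) t 1) d4)).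
    rewrite scaler0 addr0 /GRing.scale/= /f.
    have := d0 t; set E := expR _ => E0.
    by field; rewrite E0 !gt_eqF.
  - move=> t t0; rewrite /f; apply: continuousM.
      apply: continuousM; first exact: cst_continuous.
      apply: continuousM; last exact: cE.
      by apply: inv_continuous; rewrite gt_eqF.
    apply: continuousV => //.
    apply: continuousD; first exact: cst_continuous.
    apply: (@continuous_comp _ _ _ (fun t => expR (s * ln t)) (fun x => x ^+ 2)).
      exact: cE.
    exact: exprn_continuous.
  - move=> t t0; rewrite /f divr_ge0 ?addr_ge0 ?sqr_ge0// mulr_ge0 ?(ltW K0)//.
    by rewrite mulr_ge0 ?expR_ge0// invr_ge0 ltW.
  - move=> t t0; rewrite /F normrM gtr0_norm ?divr_gt0//.
    rewrite ler_pM2l ?divr_gt0// ler_norml.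
    by rewrite (ltW (atan_gtNpi2 _)) (ltW (atan_ltpi2 _)).
apply: (le_integrable _ _ _ iff) => //.
  by apply/measurable_EFinP; exact: measurable_gamma_weight.
move=> t; rewrite /= in_itv/= andbT => t0; rewrite lee_fin.
rewrite ger0_norm ?gamma_weight_ge0// (le_trans _ (ler_norm _))//.
rewrite /f /gamma_weight expR_mulN_ln//.
rewrite ler_pdivlMr; last by rewrite ltr_pwDl// sqr_ge0.
rewrite [t^-1 * _]mulrC [K * _]mulrC -[leLHS]mulrA ler_pM2l ?divr_gt0 ?expR_gt0//.
rewrite mulrDr mulr1 /K lerD//.
  by rewrite -expR0 ler_expR oppr_le0 ltW.
by rewrite mulrC -expRM_natl mulrA expR_mul_ln_le.
Qed.

Definition euler_integrand z t : R[i] := cpow t (z - 1) * (expR (- t))%:C.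

Lemma cabs_euler_integrand z t :
  cabs (euler_integrand z t) = gamma_weight (Re z) t.
Proof.
by rewrite cabsM cabs_cpow cabs_real ger0_norm ?expR_ge0// cReD /=.
Qed.

Lemma measurable_Re_euler_integrand z :
  measurable_fun pos (fun t => Re (euler_integrand z t)).
Proof.
rewrite (_ : (fun _ => _) = fun t => expR (ln t * Re (z - 1)) *
  cos (ln t * Im (z - 1)) * expR (- t)); last first.
  by apply/funext => t; rewrite /euler_integrand cReM Re_cpow /= mulr0 subr0.
apply: measurable_funTS; apply: measurable_funM; last first.
  by apply: measurableT_comp => //; exact: measurableT_comp.
apply: measurable_funM.
  by apply: measurableT_comp => //; exact: measurable_funM.
apply: measurableT_comp; last exact: measurable_funM.
by apply: continuous_measurable_fun; exact: continuous_cos.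
Qed.

Lemma measurable_Im_euler_integrand z :
  measurable_fun pos (fun t => Im (euler_integrand z t)).
Proof.
rewrite (_ : (fun _ => _) = fun t => expR (ln t * Re (z - 1)) *
  sin (ln t * Im (z - 1)) * expR (- t)); last first.
  by apply/funext => t; rewrite /euler_integrand cImM Im_cpow /= mulr0 add0r.
apply: measurable_funTS; apply: measurable_funM; last first.
  by apply: measurableT_comp => //; exact: measurableT_comp.
apply: measurable_funM.
  by apply: measurableT_comp => //; exact: measurable_funM.
apply: measurableT_comp; last exact: measurable_funM.
by apply: continuous_measurable_fun; exact: continuous_sin.
Qed.

Lemma cintegrable_euler z : 0 < Re z -> cintegrable mu pos (euler_integrand z).
Proof.
move=> z0; have iw := integrable_gamma_weight z0; split.
  apply: (le_integrable_EFin _ _ _ iw) => //; first exact: measurable_Re_euler_integrand.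
  by move=> t _; rewrite (le_trans (normr_Re_le _))// cabs_euler_integrand.
apply: (le_integrable_EFin _ _ _ iw) => //; first exact: measurable_Im_euler_integrand.
by move=> t _; rewrite (le_trans (normr_Im_le _))// cabs_euler_integrand.
Qed.

(** The bound depends on Re z alone, so it is uniform on vertical lines. The factor 2 comes from
    estimating the two components separately. *)
Lemma cabs_euler_gamma_le z : 0 < Re z ->
  cabs (euler_gamma z) <= 2 * Rintegral mu pos (gamma_weight (Re z)).
Proof.
move=> z0; have iw := integrable_gamma_weight z0.
have [i1 i2] := cintegrable_euler z0.
rewrite (le_trans (cabs_le_ReIm _))// mulr2n mulrDl !mul1r lerD//.
  rewrite (le_trans (le_normr_Rintegral _ i1))//.
  apply: le_Rintegral; [by []|exact: integrable_norm|exact: iw|].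
  by move=> t _; have := normr_Re_le (euler_integrand z t); rewrite cabs_euler_integrand.
rewrite (le_trans (le_normr_Rintegral _ i2))//.
apply: le_Rintegral; [by []|exact: integrable_norm|exact: iw|].
by move=> t _; have := normr_Im_le (euler_integrand z t); rewrite cabs_euler_integrand.
Qed.

End euler_integrand.

(** * Functional equation, decay and continuity of Euler's integral *)

Section gamma_line.
Variable R : realType.
Local Notation mu := (@lebesgue_measure R).
Local Notation pos := (`]0, +oo[%classic : set R).
Implicit Types (s t x y : R) (z k : R[i]).

Lemma cvg_expR_decay (a C : R) : 0 < a ->
  C * expR (- (a * n.+1%:R)) @[n --> \oo] --> 0.
Proof.
move=> a0.
rewrite (_ : (fun n : nat => _) = geometric (C * expR (- a)) (expR (- a))).
  by apply: cvg_geometric; rewrite ger0_norm ?expR_ge0// -expR0 ltr_expR oppr_lt0.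
apply/funext => n; rewrite /geometric /= -mulrA -exprS -expRM_natl.
by congr (_ * expR _); ring.
Qed.

Lemma cvg0_normr_le (u v : nat -> R) : (forall n, `|u n| <= v n) ->
  v n @[n --> \oo] --> 0 -> u n @[n --> \oo] --> 0.
Proof.
move=> uv v0; apply: (@squeeze_cvgr _ _ _ _ (\- v) v) => //.
  by apply: nearW => n; rewrite -ler_norml.
by rewrite -oppr0; exact: cvgN.
Qed.

Lemma cpow_pred t z : 0 < t -> cpow t (z - 1) = (t^-1)%:C * cpow t z.
Proof.
move=> t0; rewrite cpowD mulrC; congr *%R.
apply: complex_ext; rewrite ?Re_cpow ?Im_cpow /= oppr0 mulr0.
  by rewrite cos0 mulr1 mulrN1 expRN lnK.
by rewrite sin0 mulr0.
Qed.

(** The combined integrand is the derivative of [F], the real part of k t^z e^-t, whose limits at 0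
    and at infinity vanish. The choices [k] = 1 and [k] = - i recover the complex identity. The
    difference is written with [- 1 *] to fit the linearity lemmas. *)
Lemma Re_euler_gamma_defect z k : 0 < Re z ->
  Re (k * (z * euler_gamma z + - 1 * euler_gamma (z + 1))) = 0.
Proof.
move=> z0.
have z1 : 0 < Re (z + 1) by rewrite cReD /= addr_gt0.
have iz := cintegrable_euler z0; have iz1 := cintegrable_euler z1.
have i1 : cintegrable mu pos (fun t => z * euler_integrand z t).
  exact: cintegrableZ.
have i2 : cintegrable mu pos (fun t => - 1 * euler_integrand (z + 1) t).
  exact: cintegrableZ.
have i3 : cintegrable mu pos (fun t => z * euler_integrand z t +
    - 1 * euler_integrand (z + 1) t).
  exact: cintegrableD.
have [i4 _] : cintegrable mu pos (fun t => k * (z * euler_integrand z t +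
    - 1 * euler_integrand (z + 1) t)).
  exact: cintegrableZ.
have -> : k * (z * euler_gamma z + - 1 * euler_gamma (z + 1)) =
    cintegral mu pos (fun t => k * (z * euler_integrand z t +
    - 1 * euler_integrand (z + 1) t)).
  by rewrite cintegralZ// cintegralD// !cintegralZ.
rewrite /cintegral [LHS]/=.
pose f t := expR (- t) * (t^-1 * Re (cpow t z * (z * k)) - Re (cpow t z * k)).
pose F t := Re (cpow t z * k) * expR (- t).
have fE t : pos t -> Re (k * (z * euler_integrand z t +
    - 1 * euler_integrand (z + 1) t)) = f t.
  rewrite /= in_itv/= andbT => t0.
  rewrite /euler_integrand addrK cpow_pred// /f.
  case: (cpow t z) => p q; case: (z) => a b; case: (k) => c d /=; ring.
have -> : Rintegral mu pos (fun t => Re (k * (z * euler_integrand z t +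
    - 1 * euler_integrand (z + 1) t))) = Rintegral mu pos f.
  by apply: eq_Rintegral => t; rewrite inE => /fE.
have iff : mu.-integrable pos (EFin \o f).
  apply: eq_integrable i4 => //.
  by move=> t; rewrite inE => /fE /= ->.
have FB t : 0 < t -> `|F t| <= cabs k * (expR (Re z * ln t) * expR (- t)).
  move=> t0; rewrite /F normrM (ger0_norm (expR_ge0 _)) mulrA ler_wpM2r ?expR_ge0//.
  by rewrite (le_trans (normr_Re_le _))// cabsM cabs_cpow mulrC [ln t * _]mulrC.
have dE t : is_derive t 1 (fun t : R => expR (- t)) (- expR (- t)).
  have d1 : is_derive t 1 (fun t : R => - t) (- 1) by apply: is_deriveN.
  have d2 : is_derive t 1 (expR \o (fun t : R => - t)) (expR (- t) * - 1).
    exact: is_derive1_comp.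
  by apply: (is_derive_eq d2); rewrite mulrN1.
have cE t : {for t, continuous (fun t : R => expR (- t))}.
  by apply: differentiable_continuous; apply/derivable1_diffP; exact: ex_derive.
have cR t w : 0 < t -> {for t, continuous (fun t => Re (cpow t z * w))}.
  move=> t0; apply: differentiable_continuous; apply/derivable1_diffP.
  by have dR := is_derive_Re_cpow z w t0; exact: ex_derive.
rewrite -[RHS](subrr 0).
apply: (@Rintegral_pos_derivative _ F f) => //.
- move=> t t0; have dR := is_derive_Re_cpow z k t0.
  apply: (is_derive_eq (is_deriveM dR (dE t))).
  by rewrite /GRing.scale/= /f; ring.
- move=> t t0; rewrite /f; apply: continuousM; first exact: cE.
  apply: continuousB; last exact: cR.
  apply: continuousM; last exact: cR.
  by apply: inv_continuous; rewrite gt_eqF.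
(* Near 0 the factor t^(Re z) alone tends to 0, as Re z > 0, and e^-t <= 1. *)
- apply: cvg0_normr_le (cvg_expR_decay (cabs k) z0) => n.
  rewrite (le_trans (FB _ (expR_gt0 _)))// ler_wpM2l ?cabs_ge0//.
  by rewrite expRK mulrN ler_piMr ?expR_ge0//.
(* Near infinity the maximum is taken for the exponent Re z + 1, one larger than that of [F], which
   leaves a spare factor 1 / t. *)
- apply: cvg0_normr_le (cvg_expR_decay (cabs k * gamma_bound (Re z + 1)) ltr01) => n.
  rewrite (le_trans (FB _ (expR_gt0 _)))// -mulrA ler_wpM2l ?cabs_ge0//.
  have zz : 0 < Re z + 1 by rewrite addr_gt0.
  have := expR_mul_ln_le zz (expR_gt0 n.+1%:R).
  rewrite expRK mul1r mulrDl mul1r expRD => h.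
  by rewrite [expR (- n.+1%:R)]expRN ler_pdivlMr ?expR_gt0// mulrAC.
Qed.

Lemma euler_gammaS z : 0 < Re z -> euler_gamma (z + 1) = z * euler_gamma z.
Proof.
move=> z0; have h1 := Re_euler_gamma_defect 1 z0.
have h2 := Re_euler_gamma_defect (- 'i) z0.
apply/esym/eqP; rewrite -subr_eq0 -mulN1r; apply/eqP; apply: complex_ext.
  by move: h1; rewrite mul1r.
move: h2; set X := (z * _ + _); case: X => a b /=; lra.
Qed.

(** Compares |z|^2 with 1 + y^2 on the line Re z = a, so that one use of Gamma (z + 1) = z Gamma z
    gains one power of 1 + y^2 in the squared modulus. *)
Lemma sqr_cabs_ge (a y : R) : Num.min (a ^+ 2) 1 * (1 + y ^+ 2) <= cabs (a +i* y) ^+ 2.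
Proof.
rewrite sqr_cabs /= mulrDr mulr1 lerD ?ge_min ?lexx//.
by rewrite ler_piMl ?sqr_ge0// ge_min lexx orbT.
Qed.

(** Each gained power moves the line one unit to the right, so the induction on [n] keeps [s]
    general. Squared moduli keep the exponents integral. *)
Lemma euler_gamma_decay n s : 0 < s -> exists C : R, forall y,
  cabs (euler_gamma (s +i* y)) ^+ 2 * (1 + y ^+ 2) ^+ n <= C.
Proof.
elim: n s => [|n IH] s s0.
  exists ((2 * Rintegral mu pos (gamma_weight s)) ^+ 2) => y.
  have h := @cabs_euler_gamma_le R (s +i* y) s0.
  by rewrite expr0 mulr1 !expr2; rewrite (ler_pM _ _ h h)// cabs_ge0.
have [C hC] := IH (s + 1) (addr_gt0 s0 ltr01).
have m0 : 0 < Num.min (s ^+ 2) 1 by rewrite lt_min ltr01 andbT exprn_gt0.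
exists (C / Num.min (s ^+ 2) 1) => y.
rewrite ler_pdivlMr//; apply: le_trans (hC y).
have -> : (s + 1) +i* y = (s +i* y) + 1 by apply: complex_ext => //=; rewrite addr0.
rewrite euler_gammaS// cabsM exprMn [(1 + y ^+ 2) ^+ n.+1]exprS.
have y1 : 0 <= 1 + y ^+ 2 by rewrite addr_ge0// sqr_ge0.
have := ler_wpM2r (mulr_ge0 (sqr_ge0 (cabs (euler_gamma (s +i* y))))
  (exprn_ge0 n y1)) (sqr_cabs_ge s y).
have rearr (m D A Y B : R) : m * Y * (A * B) <= D * (A * B) ->
    A * (Y * B) * m <= D * A * B.
  by rewrite -[D * A * B]mulrA; congr (_ <= _); ring.
exact: rearr.
Qed.

(** With [phi] equal to cos or sin this is the real or imaginary part of Gamma on the line Re z = s;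
    continuity in y serves to obtain measurability. *)
Lemma continuous_euler_integral s (phi : R -> R) : 0 < s -> continuous phi ->
  (forall x, `|phi x| <= 1) ->
  continuous (fun y => Rintegral mu pos
    (fun t => gamma_weight s t * phi (ln t * y))).
Proof.
move=> s0 cphi phi1 y.
have iw := integrable_gamma_weight s0.
have mphi := continuous_measurable_fun cphi.
have b u t : `|gamma_weight s t * phi (ln t * u)| <= gamma_weight s t.
  rewrite normrM (ger0_norm (gamma_weight_ge0 _ _)).
  by rewrite ler_piMr ?gamma_weight_ge0.
apply: (@continuity_under_integral R _ _ mu
  (fun u t => gamma_weight s t * phi (ln t * u)) pos _ (y - 1) (y + 1) _ _
  (gamma_weight s)) => //.
- move=> u _; apply: (le_integrable_EFin _ _ _ iw) => //.
  apply: measurable_funM; first exact: measurable_gamma_weight.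
  apply: measurable_funTS; apply: measurableT_comp => //.
  exact: measurable_funM.
- apply: aeW => t _ u _; apply: cvgM; first exact: cvg_cst.
  apply: (@continuous_comp _ _ _ (fun u => ln t * u) phi); last exact: cphi.
  by apply: cvgM; [exact: cvg_cst|exact: cvg_id].
- by move=> u _; apply: aeW => t _; exact: b.
- by rewrite inE /= in_itv/= ltrBlDr ltrDl ltr01.
Qed.

Lemma cmeasurable_euler_gamma s : 0 < s ->
  cmeasurable (fun y : R => euler_gamma (s +i* y)).
Proof.
move=> s0; split; apply: continuous_measurable_fun.
- rewrite (_ : (fun _ => _) = fun y => Rintegral mu pos
    (fun t => gamma_weight s t * cos (ln t * y))).
    by apply: continuous_euler_integral => //; [exact: continuous_cos|exact: cos_max].
  apply/funext => y; apply: eq_Rintegral => t _.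
  rewrite cReM Re_cpow /= oppr0 addr0 mulr0 subr0 /gamma_weight.
  by rewrite mulrAC.
- rewrite (_ : (fun _ => _) = fun y => Rintegral mu pos
    (fun t => gamma_weight s t * sin (ln t * y))).
    by apply: continuous_euler_integral => //; [exact: continuous_sin|exact: sin_max].
  apply/funext => y; apply: eq_Rintegral => t _.
  rewrite cImM Im_cpow /= oppr0 addr0 mulr0 add0r /gamma_weight.
  by rewrite mulrAC.
Qed.

End gamma_line.

(** * The continued Gamma function on a line that avoids the poles *)

Section cgamma_line.
Variable R : realType.
Implicit Types (s y : R).

Lemma cgamma_lineE s y : let n := Num.truncn (1 - s) in
  cgamma (s +i* y) = euler_gamma ((s + n%:R) +i* y) *
    (\prod_(k < n) ((s + k%:R) +i* y))^-1.
Proof.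
have natE n : (s +i* y) + n%:R = (s + n%:R) +i* y.
  by rewrite -(rmorph_nat (real_complex R)); apply: complex_ext => //=; rewrite addr0.
rewrite /cgamma /= natE; congr (_ / _).
by apply: eq_bigr => k _; rewrite natE.
Qed.

(** The shift chosen by [cgamma] lands in the half-plane where Euler's integral converges. *)
Lemma addr_truncn_onem_gt0 s : 0 < s + (Num.truncn (1 - s))%:R.
Proof.
have [s1|s1] := lerP 0 (1 - s).
  have /andP[_] := truncn_itv s1; rewrite -natr1; lra.
have s0 : 0 < s by lra.
by rewrite ltr_pwDl.
Qed.

Lemma cmeasurable_prod_line n (a : nat -> R) :
  cmeasurable (fun y : R => \prod_(k < n) (a k +i* y)).
Proof.
elim: n => [|n IH].
  by under eq_fun do rewrite big_ord0; exact: cmeasurable_cst.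
under eq_fun do rewrite big_ord_recr /=.
by apply: cmeasurableM => //; apply: cmeasurable_Complex.
Qed.

(** Keeping only the real part of each factor gives a bound uniform in [y]; for [a k] = s + k it is
    positive off the poles. *)
Lemma cabs_prod_line_ge n (a : nat -> R) y :
  \prod_(k < n) `|a k| <= cabs (\prod_(k < n) (a k +i* y)).
Proof.
elim: n => [|n IH]; first by rewrite !big_ord0 /cabs Normc.normc1.
rewrite !big_ord_recr /= cabsM ler_pM ?prodr_ge0//.
exact: (normr_Re_le (a n +i* y)).
Qed.

Variable s : R.
Hypothesis s_nonpole : forall k : nat, s + k%:R != 0.

Let prod_neq0 n y : \prod_(k < n) ((s + k%:R) +i* y) != 0.
Proof.
apply/prodf_neq0 => k _; apply/eqP => -[] /eqP.
by rewrite (negbTE (s_nonpole k)).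
Qed.

Lemma cmeasurable_cgamma_line : cmeasurable (fun y : R => cgamma (s +i* y)).
Proof.
under eq_fun do rewrite cgamma_lineE.
apply: cmeasurableM.
  exact/cmeasurable_euler_gamma/addr_truncn_onem_gt0.
apply: cmeasurableV; first exact: (cmeasurable_prod_line _ (fun k => s + k%:R)).
by move=> y; exact: prod_neq0.
Qed.

(** All the decay comes from the Euler factor on its shifted line; the denominator of the
    continuation is only bounded away from 0. *)
Lemma cgamma_line_decay m : exists2 C : R, 0 <= C & forall y,
  cabs (cgamma (s +i* y)) <= C * (1 + y ^+ 2) ^- m.
Proof.
(* The exponent is doubled because the bound concerns the squared modulus, and a square root
   follows. *)
have [C hC] := euler_gamma_decay (m + m) (addr_truncn_onem_gt0 s).
set n := Num.truncn (1 - s) in hC.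
pose B := \prod_(k < n) `|s + k%:R|.
have B0 : 0 < B by apply: prodr_gt0 => k _; rewrite normr_gt0.
exists (Num.sqrt C / B) => [|y]; first by rewrite divr_ge0 ?sqrtr_ge0 ?ltW.
have y0 : 0 < 1 + y ^+ 2 by rewrite ltr_pwDl ?sqr_ge0.
rewrite cgamma_lineE -/n cabsM cabsV.
rewrite ler_pdivlMr ?exprn_gt0// mulrAC ler_pM ?invr_ge0 ?cabs_ge0//.
- by rewrite mulr_ge0 ?cabs_ge0 ?exprn_ge0 ?(ltW y0).
- rewrite -[leLHS]ger0_norm ?mulr_ge0 ?cabs_ge0 ?exprn_ge0 ?(ltW y0)// -sqrtr_sqr.
  rewrite ler_wsqrtr// exprMn -exprM muln2 -addnn; exact: hC.
rewrite lef_pV2 ?posrE ?cabs_gt0 ?prod_neq0//.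
exact: (cabs_prod_line_ge _ (fun k => s + k%:R)).
Qed.

End cgamma_line.

(** * The kernel on the integration lines *)

(** By Tonelli the integral of |f g| is the product of two finite integrals. *)
Lemma integrable_prod_mul d1 d2 (T1 : measurableType d1) (T2 : measurableType d2)
    (R : realType) (m1 : {sigma_finite_measure set T1 -> \bar R})
    (m2 : {sigma_finite_measure set T2 -> \bar R}) (f : T1 -> R) (g : T2 -> R) :
  m1.-integrable setT (EFin \o f) -> m2.-integrable setT (EFin \o g) ->
  (m1 \x m2)%E.-integrable setT (fun x => (f x.1 * g x.2)%:E).
Proof.
move=> /integrableP[/measurable_EFinP mf foo] /integrableP[/measurable_EFinP mg goo].
apply/integrable12ltyP.
  apply/measurable_EFinP; apply: measurable_funM.
    by apply: measurableT_comp => //; exact: measurable_fst.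
  by apply: measurableT_comp => //; exact: measurable_snd.
have mg' : measurable_fun setT (fun y => `|g y|%:E).
  by apply/measurable_EFinP; exact: measurableT_comp.
have mf' : measurable_fun setT (fun y => `|f y|%:E).
  by apply/measurable_EFinP; exact: measurableT_comp.
have gfin : (\int[m2]_y `|g y|%:E)%E \is a fin_num.
  by rewrite ge0_fin_numE// integral_ge0.
rewrite (eq_integral (fun x => (`|f x|%:E * (fine (\int[m2]_y `|g y|%:E))%:E)%E)).
  rewrite ge0_integralZr//.
    by rewrite fineK// lte_mul_pinfty ?integral_ge0// ge0_fin_numE ?integral_ge0.
  by rewrite lee_fin fine_ge0// integral_ge0.
move=> x _ /=; under eq_integral do rewrite normrM EFinM.
by rewrite ge0_integralZl// fineK.
Qed.

(** * The integrable weight on R^3 *)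

Section lines_dominating.
Variable R : realType.
Local Notation mu := (@lebesgue_measure R).

Definition cauchy_weight (x : R) : R := (1 + x ^+ 2)^-1.

Lemma cauchy_weight_gt0 x : 0 < cauchy_weight x.
Proof. by rewrite invr_gt0 ltr_pwDl// sqr_ge0. Qed.

Lemma integrable_cauchy_weight : mu.-integrable setT (EFin \o cauchy_weight).
Proof.
have cw : continuous cauchy_weight by exact: continuous_oneDsqrV.
apply/integrableP; split.
  by apply/measurable_EFinP; exact: continuous_measurable_fun.
under eq_integral do rewrite /= ger0_norm ?ltW ?cauchy_weight_gt0//.
rewrite ge0_symfun_integralT//.
- rewrite -set_itvcy [X in (_ * X)%E](_ : _ = (pi / 2)%:E); last exact: integral0y_oneDsqr.
  by rewrite -EFinM ltry.
- by move=> x; rewrite ltW// cauchy_weight_gt0.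
- by move=> x; rewrite /= /cauchy_weight sqrrN.
Qed.

(** The product form makes the reciprocal integrable one variable at a time, while each factor 1 +
    t_j^2 stays below the whole. *)
Definition lines_weight (t : R * R * R) : R :=
  (1 + t.1.1 ^+ 2) * (1 + t.1.2 ^+ 2) * (1 + t.2 ^+ 2).

Lemma integrable_lines_weight :
  (@lebesgue3 R).-integrable setT (EFin \o (fun t => (lines_weight t)^-1)).
Proof.
have i1 := integrable_cauchy_weight.
have i2 := integrable_prod_mul i1 i1.
have i3 := @integrable_prod_mul _ _ _ _ _ (@lebesgue2 R) _
  (fun x => cauchy_weight x.1 * cauchy_weight x.2) _ i2 i1.
apply: eq_integrable i3 => //.
by move=> t _ /=; rewrite /lines_weight !invfM.
Qed.

End lines_dominating.

(** * Measurability and decay of the kernel *)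

Section kernel_lines.
Variable R : realType.
Local Notation T3 := (measurableTypeR R * measurableTypeR R * measurableTypeR R)%type.
Implicit Types (t : R * R * R) (f g : R[i] -> R[i] -> R[i] -> R[i]).

Definition lines_measurable (c : R) f := cmeasurable (T := T3) (on_lines c f).

Lemma integrable_lines_dominated (c C : R) f : lines_measurable c f ->
  (forall t, cabs (on_lines c f t) <= C * (lines_weight t)^-1) ->
  lines_integrable c f.
Proof.
move=> mf fC.
apply: (cintegrable_dominated mf _ fC).
have := @integrableZl _ T3 R (@lebesgue3 R) setT measurableT C _
  (integrable_lines_weight R).
by apply: eq_integrable => // t _ /=; rewrite EFinM.
Qed.

Lemma measurable_coord1 : measurable_fun setT (fun t : T3 => t.1.1 : R).
Proof. by apply: measurableT_comp; [exact: measurable_fst|exact: measurable_fst]. Qed.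

Lemma measurable_coord2 : measurable_fun setT (fun t : T3 => t.1.2 : R).
Proof. by apply: measurableT_comp; [exact: measurable_snd|exact: measurable_fst]. Qed.

Lemma measurable_coord3 : measurable_fun setT (fun t : T3 => t.2 : R).
Proof. exact: measurable_snd. Qed.

Lemma line_half (a b : R) : (a +i* b) / 2 = (a / 2) +i* (b / 2).
Proof.
rewrite -(rmorph_nat (real_complex R)) -rmorphV ?unitfE ?pnatr_eq0//.
by apply: complex_ext => /=; ring.
Qed.

Lemma half_line (a b : R) : 1 / 2 * (a +i* b) = (a / 2) +i* (b / 2).
Proof. by rewrite mul1r mulrC line_half. Qed.

(** Every argument becomes a constant real part [+i*] a linear form in t, the shape in which the
    lemmas on vertical lines apply. *)
Lemma kernelK_lineE (M r12 r13 r23 w1 w2 w3 c t1 t2 t3 : R) :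
  kernelK M r12 r13 r23 w1 w2 w3 (c +i* t1) (c +i* t2) (c +i* t3) =
  cpow M ((3 * c - 1) +i* (t1 + t2 + t3))
  * cpow w1 ((- c) +i* (- t1)) * cpow w2 ((- c) +i* (- t2))
  * cpow w3 ((- c) +i* (- t3))
  * cgamma (((3 * c - 1) / 2) +i* ((t1 + t2 + t3) / 2))
  * cgamma (((c - 1) / 2) +i* ((t1 + t3 - t2) / 2))
  * cgamma (((c - 1) / 2) +i* ((t2 + t3 - t1) / 2))
  * cgamma (((c + 3) / 2) +i* ((t1 + t2 - t3) / 2))
  * cpow r12 (((- c - 3) / 2) +i* ((t3 - t1 - t2) / 2))
  * cpow r13 (((- c + 1) / 2) +i* ((t2 - t1 - t3) / 2))
  * cpow r23 (((- c + 1) / 2) +i* ((t1 - t2 - t3) / 2)).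
Proof.
have e3 : 3 = 3%:C :> R[i] by rewrite rmorph_nat.
set z1 := c +i* t1; set z2 := c +i* t2; set z3 := c +i* t3.
have a1 : z1 + z2 + z3 - 1 = (3 * c - 1) +i* (t1 + t2 + t3).
  by apply: complex_ext => /=; ring.
have a2 : z1 + z3 - z2 - 1 = (c - 1) +i* (t1 + t3 - t2).
  by apply: complex_ext => /=; ring.
have a3 : z2 + z3 - z1 - 1 = (c - 1) +i* (t2 + t3 - t1).
  by apply: complex_ext => /=; ring.
have a4 : z1 + z2 - z3 + 3 = (c + 3) +i* (t1 + t2 - t3).
  by rewrite e3; apply: complex_ext => /=; ring.
have b1 : z3 - z1 - z2 - 3 = (- c - 3) +i* (t3 - t1 - t2).
  by rewrite e3; apply: complex_ext => /=; ring.
have b2 : z2 - z1 - z3 + 1 = (- c + 1) +i* (t2 - t1 - t3).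
  by apply: complex_ext => /=; ring.
have b3 : z1 - z2 - z3 + 1 = (- c + 1) +i* (t1 - t2 - t3).
  by apply: complex_ext => /=; ring.
by rewrite /kernelK a1 a2 a3 a4 b1 b2 b3 !half_line !line_half.
Qed.

(** The hypotheses invert the coordinates y1, y2, y3. Each y_i occurs in two of the three t_j, hence
    the square; each t_j costs a factor 2 in 1 + (a - b)^2 <= 2 (1 + a^2) (1 + b^2), hence 8. *)
Lemma lines_weight_le t (y1 y2 y3 : R) :
  t.1.1 = y1 - y3 -> t.1.2 = y1 - y2 -> t.2 = y2 + y3 ->
  lines_weight t <=
  8 * ((1 + y1 ^+ 2) * (1 + y2 ^+ 2) * (1 + y3 ^+ 2)) ^+ 2.
Proof.
(* The sum y2 + y3 becomes the difference y2 - (- y3), so that [le2] serves all three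
   coordinates. *)
move=> e1 e2; rewrite -[y3 in y2 + y3]opprK => e3.
have le2 (a b : R) : 1 + (a - b) ^+ 2 <= 2 * ((1 + a ^+ 2) * (1 + b ^+ 2)).
  have h1 := sqr_ge0 (a + b); have h2 := sqr_ge0 (a * b).
  have -> : 2 * ((1 + a ^+ 2) * (1 + b ^+ 2)) =
    1 + (a - b) ^+ 2 + (a + b) ^+ 2 + 1 + 2 * (a * b) ^+ 2 by ring.
  by rewrite -!addrA lerD2l lerDl addr_ge0// addr_ge0// mulr_ge0.
have p (a : R) : 0 <= 1 + a ^+ 2 by rewrite addr_ge0// sqr_ge0.
rewrite /lines_weight.
have h1 := le2 y1 y3; rewrite -e1 in h1.
have h2 := le2 y1 y2; rewrite -e2 in h2.
have h3 := le2 y2 (- y3); rewrite -e3 sqrrN in h3.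
apply: le_trans (ler_pM (mulr_ge0 (p _) (p _)) (p _) (ler_pM (p _) (p _) h1 h2) h3) _.
by rewrite le_eqVlt; apply/orP; left; apply/eqP; ring.
Qed.

Section off_poles.
Variables (M r12 r13 r23 c : R).
Hypothesis (hc : 0 < c) (hc13 : c <> 1 / 3) (hc1 : c <> 1).

(** Since c > 0, both (3 c - 1) / 2 and (c - 1) / 2 exceed - 1/2, so 0 is the only pole their lines
    could meet; the excluded values of c are exactly these cases. *)
Let nonpole1 (k : nat) : (3 * c - 1) / 2 + k%:R != 0.
Proof.
case: k => [|k]; first by rewrite addr0; apply/eqP => h; apply: hc13; lra.
have : 1 <= k.+1%:R :> R by rewrite ler1n.
move: (k.+1%:R : R) => x x1; suff : 0 < (3 * c - 1) / 2 + x by move/lt0r_neq0.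
have c0 := hc; lra.
Qed.

Let nonpole2 (k : nat) : (c - 1) / 2 + k%:R != 0.
Proof.
case: k => [|k]; first by rewrite addr0; apply/eqP => h; apply: hc1; lra.
have : 1 <= k.+1%:R :> R by rewrite ler1n.
move: (k.+1%:R : R) => x x1; suff : 0 < (c - 1) / 2 + x by move/lt0r_neq0.
have c0 := hc; lra.
Qed.

Let nonpole4 (k : nat) : (c + 3) / 2 + k%:R != 0.
Proof. have k0 : 0 <= k%:R :> R by []. by have c0 := hc; rewrite gt_eqF//; lra. Qed.

Lemma kernelK_lines_measurable (w1 w2 w3 : R) :
  lines_measurable c (kernelK M r12 r13 r23 w1 w2 w3).
Proof.
have m1 := measurable_coord1; have m2 := measurable_coord2.
have m3 := measurable_coord3.
rewrite /lines_measurable /on_lines; under eq_fun do rewrite kernelK_lineE.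
have mpow (a b : R) (y : T3 -> R) : measurable_fun setT y ->
    cmeasurable (fun t : T3 => cpow a (b +i* y t)).
  by move=> my; apply: cmeasurable_cpow; exact: cmeasurable_Complex.
have mgam (s : R) (y : T3 -> R) : (forall k : nat, s + k%:R != 0) ->
    measurable_fun setT y -> cmeasurable (fun t : T3 => cgamma (s +i* y t)).
  move=> hs my.
  exact: (cmeasurable_comp (cmeasurable_cgamma_line hs) my).
have mN (y : T3 -> R) : measurable_fun setT y -> measurable_fun setT (fun t : T3 => - y t).
  by move=> my; exact: measurableT_comp.
have mD (y z : T3 -> R) : measurable_fun setT y -> measurable_fun setT z ->
    measurable_fun setT (fun t : T3 => y t + z t).
  by move=> my mz; exact: measurable_funD.
have mh (y : T3 -> R) : measurable_fun setT y -> measurable_fun setT (fun t : T3 => y t / 2).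
  by move=> my; exact: measurable_funM.
have m1N := mN _ m1; have m2N := mN _ m2; have m3N := mN _ m3.
have m12 := mD _ _ m1 m2; have m12N := mD _ _ m1 m2N.
have m31N := mD _ _ m3 m1N; have m21N := mD _ _ m2 m1N.
apply: cmeasurableM; last exact: (mpow _ _ _ (mh _ (mD _ _ m12N m3N))).
apply: cmeasurableM; last exact: (mpow _ _ _ (mh _ (mD _ _ m21N m3N))).
apply: cmeasurableM; last exact: (mpow _ _ _ (mh _ (mD _ _ m31N m2N))).
apply: cmeasurableM; last exact: (mgam _ _ nonpole4 (mh _ (mD _ _ m12 m3N))).
apply: cmeasurableM;
  last exact: (mgam _ _ nonpole2 (mh _ (mD _ _ (mD _ _ m2 m3) m1N))).
apply: cmeasurableM;
  last exact: (mgam _ _ nonpole2 (mh _ (mD _ _ (mD _ _ m1 m3) m2N))).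
apply: cmeasurableM; last exact: (mgam _ _ nonpole1 (mh _ (mD _ _ m12 m3))).
apply: cmeasurableM; last exact: (mpow _ _ _ m3N).
apply: cmeasurableM; last exact: (mpow _ _ _ m2N).
apply: cmeasurableM; last exact: (mpow _ _ _ m1N).
exact: (mpow _ _ _ (mD _ _ m12 m3)).
Qed.

Lemma cabs_kernelK_le (w1 w2 w3 : R) : exists2 C : R, 0 <= C & forall t,
  cabs (on_lines c (kernelK M r12 r13 r23 w1 w2 w3) t) <=
  C * (lines_weight t)^-1 * (lines_weight t)^-1.
Proof.
(* Order 4 is forced by W <= 8 (Y1 Y2 Y3)^2: the target W^-2 needs the fourth powers, with constant
   64 = 8^2. The second and third arguments share a real part, hence the constant [C2]. *)
have [C1 C10 h1] := cgamma_line_decay nonpole1 4.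
have [C2 C20 h2] := cgamma_line_decay nonpole2 4.
have [C4 C40 h4] := cgamma_line_decay nonpole4 0.
(* The moduli of the seven powers depend only on the real parts of the exponents, so their product
   [E] is constant on the lines. *)
pose e (a b : R) := expR (ln a * b).
pose E := e M (3 * c - 1) * e w1 (- c) * e w2 (- c) * e w3 (- c) *
  e r12 ((- c - 3) / 2) * e r13 ((- c + 1) / 2) * e r23 ((- c + 1) / 2).
have E0 : 0 <= E by rewrite !mulr_ge0 ?expR_ge0.
exists (E * C1 * C2 * C2 * C4 * 64) => [|[[t1 t2] t3]]; first by do 5 (apply: mulr_ge0 => //).
have cabs_cpow_line (a x y : R) : cabs (cpow a (x +i* y)) = expR (ln a * x).
  exact: cabs_cpow.
rewrite -[X in cabs X <= _]/(kernelK M r12 r13 r23 w1 w2 w3 (c +i* t1)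
  (c +i* t2) (c +i* t3)).
rewrite kernelK_lineE cabs_prod11 !cabs_cpow_line.
have w0 : 0 < lines_weight (t1, t2, t3).
  by rewrite !mulr_gt0// ltr_pwDl// sqr_ge0.
move: (h1 ((t1 + t2 + t3) / 2)) (h2 ((t1 + t3 - t2) / 2))
  (h2 ((t2 + t3 - t1) / 2)) (h4 ((t1 + t2 - t3) / 2)).
set y1 := (t1 + t2 + t3) / 2; set y2 := (t1 + t3 - t2) / 2.
set y3 := (t2 + t3 - t1) / 2; set y4 := (t1 + t2 - t3) / 2.
rewrite expr0 invr1 mulr1.
set g1 := cabs (cgamma (((3 * c - 1) / 2) +i* y1)).
set g2 := cabs (cgamma (((c - 1) / 2) +i* y2)).
set g3 := cabs (cgamma (((c - 1) / 2) +i* y3)).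
set g4 := cabs (cgamma (((c + 3) / 2) +i* y4)).
set W := lines_weight _ in w0 *.
set Y1 := 1 + y1 ^+ 2; set Y2 := 1 + y2 ^+ 2; set Y3 := 1 + y3 ^+ 2.
have [Y10 Y20 Y30] : [/\ 0 < Y1, 0 < Y2 & 0 < Y3].
  by split; rewrite ltr_pwDl// sqr_ge0.
move=> k1 k2 k3 k4.
have hW : W <= 8 * (Y1 * Y2 * Y3) ^+ 2.
  by apply: lines_weight_le => /=; rewrite /y1 /y2 /y3; field.
have g12 : g1 * g2 * g3 * g4 <= C1 * Y1 ^- 4 * (C2 * Y2 ^- 4) * (C2 * Y3 ^- 4) * C4.
  by rewrite !ler_pM ?mulr_ge0 ?cabs_ge0.
have hY : (Y1 ^- 4 * Y2 ^- 4 * Y3 ^- 4) <= 64 * (W^-1 * W^-1).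
  have Y0 : 0 < Y1 * Y2 * Y3 by rewrite !mulr_gt0.
  rewrite -!exprVn -!exprMn -!invfM exprVn ler_pdivlMr ?(mulr_gt0 w0 w0)//.
  rewrite mulrC ler_pdivrMr ?exprn_gt0//.
  have -> : 64 * (Y1 * Y2 * Y3) ^+ 4 =
    (8 * (Y1 * Y2 * Y3) ^+ 2) * (8 * (Y1 * Y2 * Y3) ^+ 2) by ring.
  by rewrite ler_pM// ltW.
apply: (@le_trans _ _ (E * (g1 * g2 * g3 * g4))).
  by rewrite le_eqVlt; apply/orP; left; apply/eqP; rewrite /E /e; ring.
apply: le_trans (ler_wpM2l E0 g12) _.
have -> : E * (C1 * Y1 ^- 4 * (C2 * Y2 ^- 4) * (C2 * Y3 ^- 4) * C4) =
  E * C1 * C2 * C2 * C4 * (Y1 ^- 4 * Y2 ^- 4 * Y3 ^- 4) by ring.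
have EC0 : 0 <= E * C1 * C2 * C2 * C4 by do 4 (apply: mulr_ge0 => //).
by apply: le_trans (ler_wpM2l EC0 hY) _; rewrite !mulrA.
Qed.

End off_poles.

End kernel_lines.

(** * Elementary rules for the operator - x d/dx *)

Section euler_operator.
Variable R : realType.
Implicit Types (f g : R -> R[i]) (x : R) (k : R[i]).

Lemma eulerD_scale f k x : cderivable f x ->
  cderivable (fun u => k * f u) x /\
  eulerD (fun u => k * f u) x = k * eulerD f x.
Proof.
move=> [fR fI].
have dR : is_derive x 1 (fun u => Re (f u)) ('D_1 (fun u => Re (f u)) x).
  exact: DeriveDef.
have dI : is_derive x 1 (fun u => Im (f u)) ('D_1 (fun u => Im (f u)) x).
  exact: DeriveDef.
have dkR : is_derive x 1 (fun u => Re (k * f u))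
    (Re k * 'D_1 (fun u => Re (f u)) x - Im k * 'D_1 (fun u => Im (f u)) x).
  rewrite (_ : (fun u => Re (k * f u)) =
    (Re k *: (fun u => Re (f u))) - (Im k *: (fun u => Im (f u)))).
    exact: is_deriveB (is_deriveZ _ dR) (is_deriveZ _ dI).
  by apply/funext => u; rewrite cReM.
have dkI : is_derive x 1 (fun u => Im (k * f u))
    (Re k * 'D_1 (fun u => Im (f u)) x + Im k * 'D_1 (fun u => Re (f u)) x).
  rewrite (_ : (fun u => Im (k * f u)) =
    (Re k *: (fun u => Im (f u))) + (Im k *: (fun u => Re (f u)))).
    exact: is_deriveD (is_deriveZ _ dI) (is_deriveZ _ dR).
  by apply/funext => u; rewrite cImM.
split; first by split; exact: ex_derive.
rewrite /eulerD /cderive !derive1E.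
rewrite (@derive_val _ _ _ _ _ _ _ dkR) (@derive_val _ _ _ _ _ _ _ dkI).
by case: k dkR dkI => p q _ _; apply: complex_ext => /=; ring.
Qed.

(** Needed to differentiate a second time: the formula for the first derivative holds only at
    positive frequencies, which still fill a neighbourhood of x. *)
Lemma eulerD_eq_pos f g x : 0 < x -> (forall u, 0 < u -> f u = g u) ->
  cderivable g x -> cderivable f x /\ eulerD f x = eulerD g x.
Proof.
move=> x0 fg [gR gI].
have nfg (p : R[i] -> R) : \near x, p (g x) = p (f x).
  by near=> u; rewrite fg//; near: u; exact: lt_nbhsr.
split.
  by split; [apply: near_eq_derivable gR|apply: near_eq_derivable gI]; exact: nfg.
rewrite /eulerD /cderive !derive1E; congr (_ * (_ +i* _)).
  by apply: near_eq_derive; near=> u; rewrite fg//; near: u; exact: lt_nbhsr.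
by apply: near_eq_derive; near=> u; rewrite fg//; near: u; exact: lt_nbhsr.
Unshelve. all: by end_near. Qed.

End euler_operator.

(** * The triple inverse Mellin integral *)

Section mellin3.
Variable R : realType.
Local Notation T3 := (measurableTypeR R * measurableTypeR R * measurableTypeR R)%type.
Variables (M r12 r13 r23 c : R).
Hypothesis (hc : 0 < c) (hc13 : c <> 1 / 3) (hc1 : c <> 1).
Implicit Types (t : R * R * R) (P Q : R[i] -> R[i] -> R[i] -> R[i]).
Local Notation K := (kernelK M r12 r13 r23).

(** These are the multipliers that one of the two factors [(lines_weight t)^-1] in the kernel bound
    can absorb. *)
Definition lines_moderate P := lines_measurable c P /\
  exists2 C : R, 0 <= C & forall t, cabs (on_lines c P t) <= C * lines_weight t.

Definition weighted P w1 w2 w3 : R[i] -> R[i] -> R[i] -> R[i] :=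
  fun D1 D2 D3 => P D1 D2 D3 * K w1 w2 w3 D1 D2 D3.

Lemma lines_weight_gt0 t : 0 < lines_weight t.
Proof. by rewrite !mulr_gt0// ltr_pwDl// sqr_ge0. Qed.

Lemma cabs_weighted_le P w1 w2 w3 : lines_moderate P ->
  exists2 C : R, 0 <= C & forall t,
    cabs (on_lines c (weighted P w1 w2 w3) t) <= C * (lines_weight t)^-1.
Proof.
move=> [_ [C C0 PC]].
have [B B0 KB] := cabs_kernelK_le M r12 r13 r23 hc hc13 hc1 w1 w2 w3.
exists (C * B) => [|t]; first exact: mulr_ge0.
rewrite cabsM; apply: le_trans (ler_pM (cabs_ge0 _) (cabs_ge0 _) (PC t) (KB t)) _.
have q0 := lines_weight_gt0 t.
rewrite le_eqVlt; apply/orP; left; apply/eqP; field.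
by rewrite gt_eqF.
Qed.

Lemma lines_measurable_weighted P w1 w2 w3 : lines_moderate P ->
  lines_measurable c (weighted P w1 w2 w3).
Proof.
move=> [mP _]; apply: (cmeasurableM mP).
exact: kernelK_lines_measurable.
Qed.

Lemma lines_integrable_weighted P w1 w2 w3 : lines_moderate P ->
  lines_integrable c (weighted P w1 w2 w3).
Proof.
move=> aP; have [C _ PC] := cabs_weighted_le w1 w2 w3 aP.
exact: (integrable_lines_dominated (lines_measurable_weighted w1 w2 w3 aP) PC).
Qed.

Lemma lines_moderate_lin a P Q : lines_moderate P -> lines_moderate Q ->
  lines_moderate (fun D1 D2 D3 => a * P D1 D2 D3 + Q D1 D2 D3).
Proof.
move=> [mP [C C0 PC]] [mQ [B B0 QB]]; split.
  apply: cmeasurableD => //; apply: cmeasurableM => //; exact: cmeasurable_cst.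
exists (cabs a * C + B) => [|t]; first by rewrite addr_ge0// mulr_ge0// cabs_ge0.
rewrite /on_lines (le_trans (cabsD_le _ _))// mulrDl lerD//; last exact: QB.
by rewrite cabsM -mulrA ler_wpM2l ?cabs_ge0//; exact: PC.
Qed.

Definition mellin3 P w1 w2 w3 := inv_mellin3 c (weighted P w1 w2 w3).

Let k3 : R[i] := (1 / (2 * pi%:C * 'i)) ^+ 3 * 'i ^+ 3.

Lemma mellin3_lin a P Q w1 w2 w3 : lines_moderate P -> lines_moderate Q ->
  mellin3 (fun D1 D2 D3 => a * P D1 D2 D3 + Q D1 D2 D3) w1 w2 w3 =
  a * mellin3 P w1 w2 w3 + mellin3 Q w1 w2 w3.
Proof.
move=> aP aQ.
have iP := lines_integrable_weighted w1 w2 w3 aP.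
have iQ := lines_integrable_weighted w1 w2 w3 aQ.
rewrite /mellin3 /inv_mellin3.
have -> : on_lines c (weighted (fun D1 D2 D3 => a * P D1 D2 D3 + Q D1 D2 D3) w1 w2 w3) =
    (fun t => a * on_lines c (weighted P w1 w2 w3) t +
              on_lines c (weighted Q w1 w2 w3) t).
  by apply/funext => t; rewrite /on_lines /weighted; ring.
rewrite cintegralD//; last exact: cintegrableZ.
by rewrite cintegralZ//; ring.
Qed.

(** One statement for the three frequencies: [D] selects the coordinate, [W u] is the integrand with
    u in the corresponding slot, and the hypothesis on [W] isolates its dependence on u as the power
    u^(- D). *)
Let eulerD_mellin3 P (D : R[i] -> R[i] -> R[i] -> R[i])
    (W : R -> R[i] -> R[i] -> R[i] -> R[i]) x w1 w2 w3 :
  (forall t, Re (on_lines c D t) = c) -> lines_measurable c D ->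
  (forall u, W u = weighted (fun D1 D2 D3 => cpow u (- D D1 D2 D3) * P D1 D2 D3)
     w1 w2 w3) ->
  lines_moderate P -> lines_moderate (fun D1 D2 D3 => D D1 D2 D3 * P D1 D2 D3) ->
  0 < x ->
  cderivable (fun u => inv_mellin3 c (W u)) x /\
  eulerD (fun u => inv_mellin3 c (W u)) x =
  inv_mellin3 c (fun D1 D2 D3 => D D1 D2 D3 * W x D1 D2 D3).
Proof.
move=> ReD mD WE aP aDP x0.
pose h := on_lines c (weighted P w1 w2 w3).
have [C C0 hC] := cabs_weighted_le w1 w2 w3 aP.
have [B B0 hB] := cabs_weighted_le w1 w2 w3 aDP.
(* The sum [C + B] lets a single function dominate both [h] and its product with [D]. *)
pose G t := (C + B) * (lines_weight t)^-1.
have q0 t : 0 <= (lines_weight t)^-1 by rewrite invr_ge0 ltW// lines_weight_gt0.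
have iG : (@lebesgue3 R).-integrable setT (EFin \o G).
  have := @integrableZl _ T3 R (@lebesgue3 R) setT measurableT (C + B) _
    (integrable_lines_weight R).
  by apply: eq_integrable => // t _ /=; rewrite EFinM.
have [|||dF eF] := @cderive_mellin R _ T3 (@lebesgue3 R) (on_lines c D) c G
  (ltW hc) ReD mD iG h x x0.
- exact: lines_measurable_weighted.
- by move=> t; rewrite (le_trans (hC t))// ler_wpM2r// lerDl.
- move=> t; rewrite /h.
  rewrite (_ : _ * _ = on_lines c (weighted (fun D1 D2 D3 => D D1 D2 D3 * P D1 D2 D3) w1 w2 w3) t).
    by rewrite (le_trans (hB t))// ler_wpM2r// lerDr.
  by rewrite /on_lines /weighted mulrA.
have FE : (fun u => inv_mellin3 c (W u)) =
    (fun u => k3 * mellin (@lebesgue3 R) (on_lines c D) h u).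
  apply/funext => u; rewrite /inv_mellin3 mulrA; congr (_ * cintegral _ _ _).
  by apply/funext => t; rewrite WE /h /on_lines /weighted mulrA.
have [dk ek] := eulerD_scale k3 dF.
rewrite FE; split => //; rewrite ek eF /inv_mellin3 mulrA.
congr (_ * cintegral _ _ _); apply/funext => t.
by rewrite WE /h /on_lines /weighted; ring.
Qed.

Let line_measurable : [/\ lines_measurable c (fun D1 _ _ => D1),
  lines_measurable c (fun _ D2 _ => D2) & lines_measurable c (fun _ _ D3 => D3)].
Proof.
split; apply: cmeasurable_Complex; try exact: measurable_cst.
- exact: measurable_coord1.
- exact: measurable_coord2.
- exact: measurable_coord3.
Qed.

Lemma opD1_mellin3 P w1 w2 w3 : lines_moderate P ->
  lines_moderate (fun D1 D2 D3 => D1 * P D1 D2 D3) -> 0 < w1 ->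
  cderivable (fun x => mellin3 P x w2 w3) w1 /\
  opD1 (mellin3 P) w1 w2 w3 = mellin3 (fun D1 D2 D3 => D1 * P D1 D2 D3) w1 w2 w3.
Proof.
move=> aP aDP w10; have [m1 m2 m3] := line_measurable.
(* Frequency 1 in the differentiated slot removes the power there by [cpow1]; the power of u stands
   in the multiplier instead. *)
have := @eulerD_mellin3 P (fun D1 _ _ => D1) (fun u => weighted P u w2 w3)
  w1 1 w2 w3 (fun=> erefl) m1 _ aP aDP w10.
have -> : (fun D1 D2 D3 => D1 * weighted P w1 w2 w3 D1 D2 D3) =
    weighted (fun D1 D2 D3 => D1 * P D1 D2 D3) w1 w2 w3.
  by apply/funext => D1; apply/funext => D2; apply/funext => D3; rewrite /weighted mulrA.
apply=> u; apply/funext => D1; apply/funext => D2; apply/funext => D3.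
by rewrite /weighted /kernelK cpow1; ring.
Qed.

Lemma opD2_mellin3 P w1 w2 w3 : lines_moderate P ->
  lines_moderate (fun D1 D2 D3 => D2 * P D1 D2 D3) -> 0 < w2 ->
  cderivable (fun x => mellin3 P w1 x w3) w2 /\
  opD2 (mellin3 P) w1 w2 w3 = mellin3 (fun D1 D2 D3 => D2 * P D1 D2 D3) w1 w2 w3.
Proof.
move=> aP aDP w20; have [m1 m2 m3] := line_measurable.
have := @eulerD_mellin3 P (fun _ D2 _ => D2) (fun u => weighted P w1 u w3)
  w2 w1 1 w3 (fun=> erefl) m2 _ aP aDP w20.
have -> : (fun D1 D2 D3 => D2 * weighted P w1 w2 w3 D1 D2 D3) =
    weighted (fun D1 D2 D3 => D2 * P D1 D2 D3) w1 w2 w3.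
  by apply/funext => D1; apply/funext => D2; apply/funext => D3; rewrite /weighted mulrA.
apply=> u; apply/funext => D1; apply/funext => D2; apply/funext => D3.
by rewrite /weighted /kernelK cpow1; ring.
Qed.

Lemma opD3_mellin3 P w1 w2 w3 : lines_moderate P ->
  lines_moderate (fun D1 D2 D3 => D3 * P D1 D2 D3) -> 0 < w3 ->
  cderivable (fun x => mellin3 P w1 w2 x) w3 /\
  opD3 (mellin3 P) w1 w2 w3 = mellin3 (fun D1 D2 D3 => D3 * P D1 D2 D3) w1 w2 w3.
Proof.
move=> aP aDP w30; have [m1 m2 m3] := line_measurable.
have := @eulerD_mellin3 P (fun _ _ D3 => D3) (fun u => weighted P w1 w2 u)
  w3 w1 w2 1 (fun=> erefl) m3 _ aP aDP w30.
have -> : (fun D1 D2 D3 => D3 * weighted P w1 w2 w3 D1 D2 D3) =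
    weighted (fun D1 D2 D3 => D3 * P D1 D2 D3) w1 w2 w3.
  by apply/funext => D1; apply/funext => D2; apply/funext => D3; rewrite /weighted mulrA.
apply=> u; apply/funext => D1; apply/funext => D2; apply/funext => D3.
by rewrite /weighted /kernelK cpow1; ring.
Qed.

Lemma lines_weight_ge t :
  [/\ 1 + t.1.1 ^+ 2 <= lines_weight t, 1 + t.1.2 ^+ 2 <= lines_weight t &
      1 + t.2 ^+ 2 <= lines_weight t].
Proof.
have p (a : R) : 1 <= 1 + a ^+ 2 by rewrite lerDl sqr_ge0.
have p0 (a : R) : 0 <= 1 + a ^+ 2 := le_trans ler01 (p a).
rewrite /lines_weight; split.
- by rewrite -mulrA ler_peMr// -[leLHS]mulr1 ler_pM.
- by rewrite mulrAC ler_peMl// -[leLHS]mulr1 ler_pM.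
- by rewrite ler_peMl// -[leLHS]mulr1 ler_pM.
Qed.

Let one : R[i] -> R[i] -> R[i] -> R[i] := fun _ _ _ => 1.

Lemma lines_moderate1 : lines_moderate one.
Proof.
split; first exact: cmeasurable_cst.
exists 1 => // t; rewrite /on_lines mul1r /cabs Normc.normc1.
have [h _ _] := lines_weight_ge t; apply: le_trans h.
by rewrite lerDl sqr_ge0.
Qed.

(** The trailing [one] is the shape produced by applying the D_j repeatedly to the integral with
    multiplier 1. *)
Lemma lines_moderate_coord (D : R[i] -> R[i] -> R[i] -> R[i]) :
  (forall t, Re (on_lines c D t) = c) ->
  (forall t, 1 + Im (on_lines c D t) ^+ 2 <= lines_weight t) ->
  lines_measurable c D ->
  lines_moderate (fun D1 D2 D3 => D D1 D2 D3 * one D1 D2 D3) /\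
  lines_moderate (fun D1 D2 D3 => D D1 D2 D3 * (D D1 D2 D3 * one D1 D2 D3)).
Proof.
move=> ReD ImD mD.
have m1 : lines_measurable c (fun D1 D2 D3 => D D1 D2 D3 * one D1 D2 D3).
  by apply: cmeasurableM => //; exact: cmeasurable_cst.
have sq t : cabs (on_lines c D t) ^+ 2 <= (c ^+ 2 + 1) * lines_weight t.
  rewrite sqr_cabs ReD mulrDl mul1r lerD//.
    rewrite ler_peMr ?sqr_ge0//; apply: le_trans (ImD t).
    by rewrite lerDl sqr_ge0.
  by apply: le_trans (ImD t); rewrite lerDr.
split.
- split=> //; exists (c ^+ 2 + 2) => [|t]; first by rewrite addr_ge0// sqr_ge0.
  rewrite /on_lines mulr1 -[X in cabs X]/(on_lines c D t).
  (* From (|D| - 1)^2 >= 0 one gets |D| <= |D|^2 + 1; the extra 1 is absorbed by one more copy of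
     the weight. *)
  have -> : c ^+ 2 + 2 = (c ^+ 2 + 1) + 1 by ring.
  rewrite mulrDl mul1r.
  have q1 : 1 <= lines_weight t by apply: le_trans (ImD t); rewrite lerDl sqr_ge0.
  have := sqr_ge0 (cabs (on_lines c D t) - 1); rewrite sqrrB1.
  move: (sq t) (cabs_ge0 (on_lines c D t)); lra.
- split; first exact: cmeasurableM.
  exists (c ^+ 2 + 1) => [|t]; first by rewrite addr_ge0// sqr_ge0.
  by rewrite /on_lines mulr1 cabsM -expr2; exact: sq.
Qed.

Let D1_ : R[i] -> R[i] -> R[i] -> R[i] := fun D1 _ _ => D1.
Let D2_ : R[i] -> R[i] -> R[i] -> R[i] := fun _ D2 _ => D2.
Let D3_ : R[i] -> R[i] -> R[i] -> R[i] := fun _ _ D3 => D3.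
Local Notation "A ** P" := (fun D1 D2 D3 => A D1 D2 D3 * P D1 D2 D3)
  (at level 39).

Let moderate1 : lines_moderate (D1_ ** one) /\ lines_moderate (D1_ ** (D1_ ** one)).
Proof.
have [m1 _ _] := line_measurable.
by apply: lines_moderate_coord => // t; have [] := lines_weight_ge t.
Qed.

Let moderate2 : lines_moderate (D2_ ** one) /\ lines_moderate (D2_ ** (D2_ ** one)).
Proof.
have [_ m2 _] := line_measurable.
by apply: lines_moderate_coord => // t; have [] := lines_weight_ge t.
Qed.

Let moderate3 : lines_moderate (D3_ ** one) /\ lines_moderate (D3_ ** (D3_ ** one)).
Proof.
have [_ _ m3] := line_measurable.
by apply: lines_moderate_coord => // t; have [] := lines_weight_ge t.
Qed.

(* The constant k is split as (k - 1) * 1 + 1: iterating mellin3_lin needs a last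
   summand without coefficient. *)
Lemma symbolR_monomials : symbolR r12 r13 r23 = fun D1 D2 D3 =>
  let l12 := (ln r12)%:C in let l13 := (ln r13)%:C in let l23 := (ln r23)%:C in
  let g := (gammaE R)%:C in
  (1 / 4 * (l12 + l13 - l23)) * (D1 * (D1 * 1)) +
  ((1 / 4 * (l12 - l13 + l23)) * (D2 * (D2 * 1)) +
  ((1 / 4 * (- l12 + l13 + l23)) * (D3 * (D3 * 1)) +
  ((- g) * (D1 * 1) + ((- g) * (D2 * 1) +
  ((1 / 4 * (4 * l12 - 4 * l13 - 4 * l23) - g) * (D3 * 1) +
  ((1 / 4 * (- 5 * l12 + 3 * l13 + 3 * l23) + g - 1) * 1 + 1)))))).
Proof.
apply/funext => D1; apply/funext => D2; apply/funext => D3.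
by rewrite /symbolR /=; ring.
Qed.

Lemma lines_moderate_symbolR : lines_moderate (symbolR r12 r13 r23).
Proof.
have [m1 m11] := moderate1; have [m2 m22] := moderate2.
have [m3 m33] := moderate3; have m0 := lines_moderate1.
rewrite symbolR_monomials; apply: (lines_moderate_lin _ m11).
apply: (lines_moderate_lin _ m22); apply: (lines_moderate_lin _ m33).
apply: (lines_moderate_lin _ m1); apply: (lines_moderate_lin _ m2).
apply: (lines_moderate_lin _ m3); exact: (lines_moderate_lin _ m0 m0).
Qed.

(** The seven integrals enter as variables tied by equations, so that after linearity [ring] only
    sees atoms. *)
Lemma mellin3_symbolR w1 w2 w3 (f d1 d2 d3 d11 d22 d33 : R[i]) :
  let J P := mellin3 P w1 w2 w3 in
  f = J one -> d1 = J (D1_ ** one) -> d2 = J (D2_ ** one) ->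
  d3 = J (D3_ ** one) -> d11 = J (D1_ ** (D1_ ** one)) ->
  d22 = J (D2_ ** (D2_ ** one)) -> d33 = J (D3_ ** (D3_ ** one)) ->
  J (symbolR r12 r13 r23) =
  1 / 4 *
    ((ln r12)%:C * (d11 + d22 - d33 + 4 * d3 - 5 * f)
     + (ln r13)%:C * (d11 + d33 - d22 - 4 * d3 + 3 * f)
     + (ln r23)%:C * (d33 + d22 - d11 - 4 * d3 + 3 * f))
  - (gammaE R)%:C * (d1 + d2 + d3 - f).
Proof.
have [m1 m11] := moderate1; have [m2 m22] := moderate2.
have [m3 m33] := moderate3; have m0 := lines_moderate1.
pose l12 := (ln r12)%:C; pose l13 := (ln r13)%:C; pose l23 := (ln r23)%:C.
pose g := (gammaE R)%:C.
move=> J; rewrite /J symbolR_monomials => ef e1 e2 e3 e11 e22 e33.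
have n1 := lines_moderate_lin
  (1 / 4 * (- 5 * l12 + 3 * l13 + 3 * l23) + g - 1) m0 m0.
have n2 := lines_moderate_lin (1 / 4 * (4 * l12 - 4 * l13 - 4 * l23) - g) m3 n1.
have n3 := lines_moderate_lin (- g) m2 n2.
have n4 := lines_moderate_lin (- g) m1 n3.
have n5 := lines_moderate_lin (1 / 4 * (- l12 + l13 + l23)) m33 n4.
have n6 := lines_moderate_lin (1 / 4 * (l12 - l13 + l23)) m22 n5.
rewrite (mellin3_lin _ _ _ _ m11 n6) (mellin3_lin _ _ _ _ m22 n5).
rewrite (mellin3_lin _ _ _ _ m33 n4) (mellin3_lin _ _ _ _ m1 n3).
rewrite (mellin3_lin _ _ _ _ m2 n2) (mellin3_lin _ _ _ _ m3 n1).
rewrite (mellin3_lin _ _ _ _ m0 m0).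
rewrite -ef -e1 -e2 -e3 -e11 -e22 -e33 /l12 /l13 /l23 /g; ring.
Qed.

Lemma opO_mellin3 w1 w2 w3 : 0 < w1 -> 0 < w2 -> 0 < w3 ->
  opO_defined (mellin3 one) w1 w2 w3 /\
  opO r12 r13 r23 (mellin3 one) w1 w2 w3 =
  mellin3 (symbolR r12 r13 r23) w1 w2 w3.
Proof.
move=> w10 w20 w30.
have [m1 m11] := moderate1; have [m2 m22] := moderate2.
have [m3 m33] := moderate3; have m0 := lines_moderate1.
have [d1 e1] := opD1_mellin3 w2 w3 m0 m1 w10.
have [d2 e2] := opD2_mellin3 w1 w3 m0 m2 w20.
have [d3 e3] := opD3_mellin3 w1 w2 m0 m3 w30.
have [d11 e11] : cderivable (fun x => opD1 (mellin3 one) x w2 w3) w1 /\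
    opD1 (opD1 (mellin3 one)) w1 w2 w3 =
    mellin3 (D1_ ** (D1_ ** one)) w1 w2 w3.
  have [d e] := opD1_mellin3 w2 w3 m1 m11 w10.
  have E u (u0 : 0 < u) := (opD1_mellin3 w2 w3 m0 m1 u0).2.
  have [h1 h2] := eulerD_eq_pos w10 E d.
  by split; [exact: h1|exact: etrans h2 e].
have [d22 e22] : cderivable (fun x => opD2 (mellin3 one) w1 x w3) w2 /\
    opD2 (opD2 (mellin3 one)) w1 w2 w3 =
    mellin3 (D2_ ** (D2_ ** one)) w1 w2 w3.
  have [d e] := opD2_mellin3 w1 w3 m2 m22 w20.
  have E u (u0 : 0 < u) := (opD2_mellin3 w1 w3 m0 m2 u0).2.
  have [h1 h2] := eulerD_eq_pos w20 E d.
  by split; [exact: h1|exact: etrans h2 e].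
have [d33 e33] : cderivable (fun x => opD3 (mellin3 one) w1 w2 x) w3 /\
    opD3 (opD3 (mellin3 one)) w1 w2 w3 =
    mellin3 (D3_ ** (D3_ ** one)) w1 w2 w3.
  have [d e] := opD3_mellin3 w1 w2 m3 m33 w30.
  have E u (u0 : 0 < u) := (opD3_mellin3 w1 w2 m0 m3 u0).2.
  have [h1 h2] := eulerD_eq_pos w30 E d.
  by split; [exact: h1|exact: etrans h2 e].
split; first by split; split; assumption.
by rewrite (mellin3_symbolR (erefl _) e1 e2 e3 e11 e22 e33).
Qed.

End mellin3.

(** Integrals and derivatives are total here, with default values; the first three conjuncts certify
    that the identity relates convergent integrals and existing derivatives. *)
Theorem mainTheorem3 (R : realType) (M : R) (z1 z2 z3 : R[i]) (c : R)
    (hM : 0 < M) (hz12 : z1 <> z2) (hz13 : z1 <> z3) (hz23 : z2 <> z3)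
    (hc : 0 < c) (hc13 : c <> 1 / 3) (hc1 : c <> 1) :
  let r12 := sqdist z1 z2 in
  let r13 := sqdist z1 z3 in
  let r23 := sqdist z2 z3 in
  forall w1 w2 w3 : R, 0 < w1 -> 0 < w2 -> 0 < w3 ->
    [/\ lines_integrable c (kernelK M r12 r13 r23 w1 w2 w3),
        lines_integrable c (kernelRK M r12 r13 r23 w1 w2 w3),
        opO_defined (calI0 M r12 r13 r23 c) w1 w2 w3 &
        calI1 M r12 r13 r23 c w1 w2 w3
          = opO r12 r13 r23 (calI0 M r12 r13 r23 c) w1 w2 w3].
Proof.
move=> r12 r13 r23 w1 w2 w3 w10 w20 w30.
have weighted1 v1 v2 v3 :
    weighted M r12 r13 r23 (fun _ _ _ => 1) v1 v2 v3 =
    kernelK M r12 r13 r23 v1 v2 v3.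
  apply/funext => D1; apply/funext => D2; apply/funext => D3.
  exact: mul1r.
have I0E : calI0 M r12 r13 r23 c = mellin3 M r12 r13 r23 c (fun _ _ _ => 1).
  apply/funext => v1; apply/funext => v2; apply/funext => v3.
  by rewrite /mellin3 weighted1.
have [dO eO] := opO_mellin3 M r12 r13 r23 hc hc13 hc1 w10 w20 w30.
(* By unfolding, [calI1] is the Mellin integral with multiplier [symbolR], so the identity itself
   closes at once and only integrability remains. *)
rewrite I0E eO; split => //.
- rewrite -weighted1; apply: lines_integrable_weighted => //.
  exact: lines_moderate1.
- apply: (lines_integrable_weighted _ _ _ _ hc hc13 hc1 w1 w2 w3).
  exact: lines_moderate_symbolR.
Qed.
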